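(* Let $A$ be an alternative finite-dimensional real $*$-algebra, let $G$ be a symmetric domain in $\mathbb{C}$ with associated axially symmetric domain $\Omega_G$, and let $f$ be a slice regular function on $\Omega_G$ with stem function $F:G\to A_{\mathbb{C}}$ such that there is a point $p\in G$ with $F(p)\in A_{\mathbb{C}}^*$. Then the zero set $V(f)=\{w\in\Omega_G: f(w)=0\}$ is contained in an adapted subset of $\Omega_G$.
   Context: A finite-dimensional alternative real $*$-algebra $A$ is a finite-dimensional unital real algebra ($\mathbb{R}=\mathbb{R}\cdot 1\subset A$) with $x(xy)=(xx)y$ and $x(yy)=(xy)y$ for all $x,y\in A$, equipped with a real-linear involution $x\mapsto x^c$ satisfying $(xy)^c=y^cx^c$ and fixing $\mathbb{R}$ pointwise. The pseudosphere is $\mathbb{S}_A=\{w\in A: w+w^c=0,\ ww^c=1\}$ (so $w^2=-1$ for $w\in\mathbb{S}_A$); the quadratic cone is $Q_A=\mathbb{R}\cup\{w\in A: w+w^c\in\mathbb{R},\ ww^c\in\mathbb{R},\ 4ww^c>(w+w^c)^2\}$, equivalently $Q_A=\mathbb{R}\cup\{x+yI:x,y\in\mathbb{R},I\in\mathbb{S}_A\}$. A symmetric domain in $\mathbb{C}$ is an open subset $G$ with $z\in G\iff\bar z\in G$ whose quotient by the relation $z\sim w\iff(z=w\text{ or }z=\bar w)$ is connected. Its associated axially symmetric domain is $\Omega_G=\{x+yI: x+yi\in G,\ x,y\in\mathbb{R},\ I\in\mathbb{S}_A\}\subset Q_A$. Put $G^+=\{z\in G:\operatorname{Im}z\ge0\}$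 and $\pi:\Omega_G\to G^+$, $\pi(x+yI)=x+|y|i$. A subset $D\subset\Omega_G$ is adapted if (1) $\pi(D)$ is discrete in $G^+$ (i.e. has no accumulation point in $G^+$), and (2) for every $x,y\in\mathbb{R}$ either $x+y\mathbb{S}_A\subset D$ or $(x+y\mathbb{S}_A)\cap D$ contains at most one element. Let $A_{\mathbb{C}}=A\otimes_{\mathbb{R}}\mathbb{C}$, whose elements are written $a+ib$ with $a,b\in A$ ($i$ central), with complex conjugation $\overline{a+ib}=a-ib$; $A_{\mathbb{C}}^*$ denotes its set of invertible elements (left and right invertibility coincide). A stem function is a holomorphic map $F:G\to A_{\mathbb{C}}$ with $F(\bar z)=\overline{F(z)}$. A slice regular function on $\Omega_G$ is a function $f:\Omega_G\to A$ induced by a stem function $F=F'+iF''$ ($F',F'':G\to A$) via $f(x+yI)=F'(x+yi)+I\,F''(x+yi)$ for $x+yi\in G$, $I\in\mathbb{S}_A$. *)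

(* Defs.v *)
From HB Require Import structures.
From mathcomp Require Import all_boot all_order all_algebra.
From mathcomp Require Import all_classical all_reals all_analysis.
From mathcomp Require Import complex.
Set Implicit Arguments.
Unset Strict Implicit.
Unset Printing Implicit Defensive.
Import Order.TTheory GRing.Theory Num.Theory.
Import numFieldNormedType.Exports.
Local Open Scope classical_set_scope.
Local Open Scope complex_scope.
Local Open Scope ring_scope.

(* [complex R] carries no topology in the libraries; it receives the one every
   numFieldType has, i.e. that of the modulus. *)
HB.instance Definition _ (R : rcfType) := NormedModule.copy R[i] R[i]^o.

(* The product is not assumed associative, so the ring structures of the
   library do not apply. *)
HB.mixin Record Vector_isAltStarAlgebra (R : realType) A & Vector R A := {
  alt_one : A;
  alt_mul : A -> A -> A;
  alt_conj : A -> A;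
  alt_one_neq0 : alt_one != 0;
  alt_mul1l : left_id alt_one alt_mul;
  alt_mul1r : right_id alt_one alt_mul;
  alt_mul_linearr : forall x, linear (alt_mul x);
  alt_mul_linearl : forall y, linear (alt_mul^~ y);
  alt_mul_altl : forall x y, alt_mul x (alt_mul x y) = alt_mul (alt_mul x x) y;
  alt_mul_altr : forall x y, alt_mul x (alt_mul y y) = alt_mul (alt_mul x y) y;
  alt_conj_linear : linear alt_conj;
  alt_conjK : involutive alt_conj;
  alt_conjM : forall x y,
    alt_conj (alt_mul x y) = alt_mul (alt_conj y) (alt_conj x);
  alt_conj_real : forall r : R, alt_conj (r *: alt_one) = r *: alt_one
}.

#[short(type="altStarAlgType")]
HB.structure Definition AltStarAlgebra (R : realType) :=
  { A of Vector_isAltStarAlgebra R A & Vector R A }.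

Notation "x ** y" := (alt_mul x y)
  (at level 40, left associativity) : ring_scope.

Section AltStarAlgebra.
Context {R : realType} {A : altStarAlgType R}.
Implicit Types (x y : R) (I w : A) (z : R[i]) (G : set R[i]) (D : set A).

Definition pseudosphere : set A :=
  [set w | w + alt_conj w = 0 /\ w ** alt_conj w = alt_one].

(* x + y I in A, where R is embedded as R . 1 *)
Definition slice_pt x y I : A := x *: alt_one + y *: I.

Definition slice_sphere x y : set A := slice_pt x y @` pseudosphere.

Definition axial_domain G : set A :=
  [set w | exists x y I,
     [/\ G (x +i* y), pseudosphere I & w = slice_pt x y I]].

Definition upper_half G : set R[i] := [set z | G z /\ 0 <= complex.Im z].

(* The graph of pi : x + y I |-> x + |y| i. *)
Definition slice_proj w z : Prop :=
  exists x y I,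
    [/\ pseudosphere I, w = slice_pt x y I & z = x +i* `|y|].

(* So slice_proj is indeed the graph of a partial function on A. *)
Lemma slice_proj_fun w z z' :
  slice_proj w z -> slice_proj w z' -> z = z'.
Proof.
suff H x y I x' y' J : pseudosphere I -> pseudosphere J ->
    slice_pt x y I = slice_pt x' y' J -> x = x' /\ y ^+ 2 = y' ^+ 2.
  move=> [x [y [I [SI -> ->]]]] [x' [y' [J [SJ e ->]]]].
  have [-> yy] := H _ _ _ _ _ _ SI SJ e.
  by rewrite -!sqrtr_sqr yy.
have conjN I1 : pseudosphere I1 -> alt_conj I1 = - (I1 : A).
  by case=> /eqP; rewrite addrC addr_eq0 => /eqP.
have conjD (u v : A) : alt_conj (u + v) = alt_conj u + alt_conj v.
  by have := alt_conj_linear 1 u v; rewrite !scale1r.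
have conj0 : alt_conj 0 = 0 :> A.
  by apply: (addrI (alt_conj 0)); rewrite -conjD !addr0.
have conjZ c (u : A) : alt_conj (c *: u) = c *: alt_conj u.
  by have := alt_conj_linear c u 0; rewrite conj0 !addr0.
have mulDr (u v t : A) : u ** (v + t) = u ** v + u ** t.
  by have := alt_mul_linearr u 1 v t; rewrite !scale1r.
have mul0r (u : A) : u ** 0 = 0.
  by apply: (addrI (u ** 0)); rewrite -mulDr !addr0.
have mulZr c (u v : A) : u ** (c *: v) = c *: (u ** v).
  by have := alt_mul_linearr u c v 0; rewrite mul0r !addr0.
have mulDl (u v t : A) : (v + t) ** u = v ** u + t ** u.
  by have := alt_mul_linearl u 1 v t; rewrite !scale1r.
have mul0l (u : A) : 0 ** u = 0.
  by apply: (addrI (0 ** u)); rewrite -mulDl !addr0.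
have mulZl c (u v : A) : (c *: v) ** u = c *: (v ** u).
  by have := alt_mul_linearl u c v 0; rewrite mul0l !addr0.
have inj1 : injective (fun r : R => r *: (alt_one : A)).
  move=> r s /eqP; rewrite -subr_eq0 -scalerBl scaler_eq0.
  by rewrite (negbTE alt_one_neq0) orbF subr_eq0 => /eqP.
have conjE x1 y1 I1 : pseudosphere I1 ->
    alt_conj (slice_pt x1 y1 I1) = slice_pt x1 (- y1) I1.
  by move=> SI; rewrite /slice_pt conjD alt_conj_real conjZ conjN// scalerN scaleNr.
have trE x1 y1 I1 : pseudosphere I1 ->
    slice_pt x1 y1 I1 + alt_conj (slice_pt x1 y1 I1) = (x1 *+ 2) *: alt_one.
  move=> SI; rewrite conjE// /slice_pt scaleNr addrACA subrr addr0.
  by rewrite -scalerDl mulr2n.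
have nmE x1 y1 I1 : pseudosphere I1 ->
    slice_pt x1 y1 I1 ** alt_conj (slice_pt x1 y1 I1) =
    (x1 ^+ 2 + y1 ^+ 2) *: alt_one.
  move=> SI; have II : I1 ** I1 = - (alt_one : A).
    have [_] := SI; rewrite conjN// -scaleN1r mulZr scaleN1r => <-.
    by rewrite opprK.
  rewrite conjE// /slice_pt mulDl !mulDr !mulZl !mulZr alt_mul1l alt_mul1r.
  rewrite alt_mul1l II !scalerN !scalerA.
  by rewrite !mulrN !scaleNr opprK [y1 * x1]mulrC addrA subrK -scalerDl -!expr2.
move=> SI SJ e.
have xx : x = x'.
  have /inj1 /(pmulrnI (isT : (0 < 2)%N)) // : (x *+ 2) *: alt_one = (x' *+ 2) *: alt_one :> A.
  by rewrite -(trE x y _ SI) -(trE x' y' _ SJ) e.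
split=> //; have /inj1 : (x ^+ 2 + y ^+ 2) *: alt_one =
    (x' ^+ 2 + y' ^+ 2) *: alt_one :> A by rewrite -(nmE x y _ SI) -(nmE x' y' _ SJ) e.
by rewrite xx => /addrI.
Qed.

Definition slice_proj_set D : set R[i] :=
  [set z | exists2 w, D w & slice_proj w z].

Definition adapted G D : Prop :=
  [/\ D `<=` axial_domain G,
      (forall z, upper_half G z -> ~ limit_point (slice_proj_set D) z)
    & forall x y, slice_sphere x y `<=` D \/
                  is_subset1 (slice_sphere x y `&` D)].

(* The complexification of A: the pair (a, b) stands for a + i b. *)
Local Notation AC := (A * A)%type.

Definition cplx_one : AC := (alt_one, 0).

Definition cplx_mul (a b : AC) : AC :=
  (a.1 ** b.1 - a.2 ** b.2, a.1 ** b.2 + a.2 ** b.1).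

Definition cplx_bar (a : AC) : AC := (a.1, - a.2).

Definition cplx_invertible (a : AC) : Prop :=
  exists b, cplx_mul a b = cplx_one /\ cplx_mul b a = cplx_one.

(* The C-linear isomorphism of the complexification with C^(dim A) given by a
   basis of A; it is what the topology of the complexification comes from. *)
Definition cplx_coord (a : AC) : 'rV[R[i]]_(\dim {:A}) :=
  \row_i (coord (vbasis {:A}) i a.1 +i* coord (vbasis {:A}) i a.2).

(* Complex differentiability: 'derivable' is over the field R[i] here. *)
Definition cplx_holomorphic G (F : R[i] -> AC) : Prop :=
  forall z, G z -> derivable (cplx_coord \o F : R[i] -> 'rV[R[i]]__) z 1.

Definition stem_function G (F : R[i] -> AC) : Prop :=
  cplx_holomorphic G F /\ (forall z, G z -> F z^*%C = cplx_bar (F z)).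

(* Only the values of F on G and of f on the axially symmetric domain matter. *)
Definition slice_induced G (F : R[i] -> AC) (f : A -> A) : Prop :=
  forall x y I, G (x +i* y) -> pseudosphere I ->
    f (slice_pt x y I) = (F (x +i* y)).1 + I ** (F (x +i* y)).2.

Definition slice_zeros G (f : A -> A) : set A :=
  [set w | axial_domain G w /\ f w = 0].

End AltStarAlgebra.

Section SymmetricDomain.
Context {R : realType}.
Implicit Type G : set R[i].

Definition conj_rel G : rel G :=
  fun z w => (val z == val w) || (val z == (val w)^*%C).

Lemma conj_rel_refl G : reflexive (@conj_rel G).
Proof. by move=> z; rewrite /conj_rel eqxx. Qed.

Lemma conj_rel_sym G : symmetric (@conj_rel G).
Proof.
move=> z w; rewrite /conj_rel eq_sym; congr (_ || _).
by apply/eqP/eqP => ->; rewrite conjcK.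
Qed.

Lemma conj_rel_trans G : transitive (@conj_rel G).
Proof.
move=> w z v; rewrite /conj_rel.
by move=> /orP[/eqP->//|/eqP->] /orP[/eqP->|/eqP->];
   rewrite ?conjcK eqxx ?orbT.
Qed.

Canonical conj_equiv G :=
  EquivRel (@conj_rel G) (@conj_rel_refl G) (@conj_rel_sym G)
    (@conj_rel_trans G).

(* G modulo z ~ z^*, with the quotient of the subspace topology of G. *)
Definition conj_quotient G := quotient_topology {eq_quot (conj_equiv G)}%qT.
HB.instance Definition _ G := Topological.on (conj_quotient G).

Definition symmetric_domain G : Prop :=
  [/\ open G, (forall z, G z <-> G z^*%C) & connected [set: conj_quotient G]].

End SymmetricDomain.

(* Main.v *)
Require Import Defs.
From mathcomp Require Import all_boot all_order all_algebra.
From mathcomp Require Import all_classical all_reals all_analysis.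
From mathcomp Require Import complex ring lra.

Set Implicit Arguments.
Unset Strict Implicit.
Unset Printing Implicit Defensive.
Import Order.TTheory GRing.Theory Num.Theory.
Import numFieldNormedType.Exports.
Local Open Scope classical_set_scope.
Local Open Scope complex_scope.
Local Open Scope ring_scope.

(** Let [g(z)] be the determinant of right multiplication by [F(z)] on the
    complexification of [A]. It is holomorphic on [G], commutes
    with conjugation, and does not vanish at [p]: in an alternative algebra,
    right multiplication by an invertible element is injective
    ([right_mul_injective], from the right Moufang identity). If [f] vanishes at
    [x + y J], then [J + i] annihilates [F(x + y i)] from the left
    ([slice_zero_left_annihilator]), so that [g(x + y i) = 0]. Hence the union of
    all spheres [x + y S] meeting the zero set of [f] projects into the zeros of
    [g]. That union is adapted as soon as the zeros of [g] do not accumulate in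
    [G], since by construction it contains a sphere or misses it.

    The identity theorem ([zeros_discrete]) reduces to a local statement: if
    the zeros of a complex differentiable function accumulate at a point, the
    function vanishes near it ([accumulating_zeros]). Differentiability alone is
    assumed, so this is proved from Goursat's lemma, without power series.
    Dividing by many zeros gives functions that are continuous, and
    differentiable outside a finite set; [goursat_square] allows for such a set.
    For these functions a weak maximum principle holds ([no_small_boundary]), and
    it contradicts the decay produced by the division. *)

(** * Integrals of continuous functions over a segment *)

Section SegmentIntegral.
Context {R : realType}.
Implicit Types (f : R -> R) (a b c e : R).

Local Notation mu := (@lebesgue_measure R).

Definition seg_int f a b : R := \int[mu]_(t in `[a, b]) f t.

Lemma continuous_segment_integrable f a b :
  {within `[a, b], continuous f} -> mu.-integrable `[a, b] (EFin \o f).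
Proof.
by move=> cf; apply: continuous_compact_integrable => //; exact: segment_compact.
Qed.

Lemma seg_int_split f a b c : a <= c -> c <= b ->
  {within `[a, b], continuous f} -> seg_int f a b = seg_int f a c + seg_int f c b.
Proof.
move=> ac cb cf; have itf := continuous_segment_integrable cf.
rewrite /seg_int -[in RHS](@Rintegral_itv_obnd_cbnd _ c).
  by rewrite -(Rintegral_itvB itf) ?bnd_simp// addrC subrK.
by apply: integrableS itf => //; apply: subset_itvr; rewrite bnd_simp.
Qed.

Lemma seg_int_affine (al be : R) a b : a <= b ->
  seg_int (fun t => al + be * t) a b = al * (b - a) + be * (b ^+ 2 - a ^+ 2) / 2.
Proof.
rewrite le_eqVlt => /predU1P[->|ab].
  by rewrite /seg_int set_itv1 Rintegral_set1; ring.
pose P : {poly R} := al *: 'X + (be / 2) *: 'X^2.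
have dP t : is_derive t (1 : R) (horner P) (al + be * t).
  have := is_derive_poly P t; congr (is_derive _ _ _ _).
  by rewrite /P linearD/= !linearZ/= derivX derivXn !hornerE/=; field.
have cP : continuous (horner P) by exact: continuous_horner.
rewrite /seg_int /Rintegral (@continuous_FTC2 _ _ (horner P))//.
- by rewrite /P !hornerE /=; field.
- apply: continuous_subspaceT => t; apply: cvgD; first exact: cvg_cst.
  by apply: cvgM; [exact: cvg_cst|exact: cvg_id].
- split=> [t _||]; first exact: (@ex_derive _ _ _ _ _ _ _ (dP t)).
  + exact/cvg_at_right_filter/cP.
  + exact/cvg_at_left_filter/cP.
- by move=> t _; rewrite derive1E; exact: (@derive_val _ _ _ _ _ _ _ (dP t)).
Qed.

Lemma le_seg_int f g a b :
  {within `[a, b], continuous f} -> {within `[a, b], continuous g} ->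
  (forall t, a <= t <= b -> f t <= g t) -> seg_int f a b <= seg_int g a b.
Proof.
by move=> cf cg fg; apply: le_Rintegral => //; exact: continuous_segment_integrable.
Qed.

Lemma affine_continuous (al be : R) : continuous (fun t : R => al + be * t).
Proof.
move=> t; apply: cvgD; first exact: cvg_cst.
by apply: cvgM; [exact: cvg_cst|exact: cvg_id].
Qed.

(** The affine functions [al - e + be * t] and [al + e + be * t] squeeze [f], and
    their integrals are explicit. *)
Lemma seg_int_near_affine f (al be e : R) a b : a <= b ->
  {within `[a, b], continuous f} ->
  (forall t, a <= t <= b -> `|f t - (al + be * t)| <= e) ->
  `|seg_int f a b - (al * (b - a) + be * (b ^+ 2 - a ^+ 2) / 2)| <= e * (b - a).
Proof.
move=> ab cf fe.
have caff (al' be' : R) : {within `[a, b], continuous (fun t : R => al' + be' * t)}.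
  by apply: continuous_subspaceT; exact: affine_continuous.
have lo : seg_int (fun t => (al - e) + be * t) a b <= seg_int f a b.
  by apply: le_seg_int => // t /fe; rewrite ler_norml => /andP[? ?]; lra.
have hi : seg_int f a b <= seg_int (fun t => (al + e) + be * t) a b.
  by apply: le_seg_int => // t /fe; rewrite ler_norml => /andP[? ?]; lra.
rewrite !seg_int_affine// in lo hi.
rewrite ler_norml; apply/andP; split; nra.
Qed.

Lemma seg_int_ge f (m : R) a b : a <= b ->
  {within `[a, b], continuous f} -> (forall t, a <= t <= b -> m <= f t) ->
  m * (b - a) <= seg_int f a b.
Proof.
move=> ab cf fm.
have -> : m * (b - a) = seg_int (fun t => m + 0 * t) a b.
  by rewrite seg_int_affine//; ring.
apply: le_seg_int => //.
  by apply: continuous_subspaceT; exact: affine_continuous.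
by move=> t /fm; rewrite mul0r addr0.
Qed.

Lemma seg_int_le f (m : R) a b : a <= b ->
  {within `[a, b], continuous f} -> (forall t, a <= t <= b -> f t <= m) ->
  seg_int f a b <= m * (b - a).
Proof.
move=> ab cf fm.
have -> : m * (b - a) = seg_int (fun t => m + 0 * t) a b.
  by rewrite seg_int_affine//; ring.
apply: le_seg_int => //.
  by apply: continuous_subspaceT; exact: affine_continuous.
by move=> t /fm; rewrite mul0r addr0.
Qed.

End SegmentIntegral.

(** * Bisection of squares *)

Section FourSection.
Context {R : realType}.
Implicit Types (x y s : R).

Definition in_square x0 y0 s0 x y := [/\ x0 <= x, x <= x0 + s0, y0 <= y & y <= y0 + s0].

Definition subsquare x0 y0 s0 x y s :=
  [/\ x0 <= x, x + s <= x0 + s0, y0 <= y & y + s <= y0 + s0].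

(** The common core of all arguments by repeated quartering. If the inequality
    failed on the whole square it would fail on one of its four quarters, hence
    on a nested sequence of squares; these shrink to a point, near which the
    inequality is assumed. Comparing [I] with a superadditive [m] instead of with
    the area is what later lets finitely many points escape differentiability. *)
Lemma square_bisection (I m : R -> R -> R -> R) x0 y0 s0 : 0 < s0 ->
  (forall x y s, 0 < s -> subsquare x0 y0 s0 x y (s + s) ->
    I x y (s + s) = I x y s + I (x + s) y s + I x (y + s) s + I (x + s) (y + s) s) ->
  (forall x y s, 0 < s -> subsquare x0 y0 s0 x y (s + s) ->
    m x y s + m (x + s) y s + m x (y + s) s + m (x + s) (y + s) s <= m x y (s + s)) ->
  (forall c d, in_square x0 y0 s0 c d -> exists2 del : R, 0 < del &
    forall x y s, 0 < s -> s < del -> subsquare x0 y0 s0 x y s ->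
      in_square x y s c d -> `|I x y s| <= m x y s) ->
  `|I x0 y0 s0| <= m x0 y0 s0.
Proof.
move=> s00 Isplit msplit loc; rewrite leNgt; apply/negP => bad0.
pose bad (q : R * R * R) := [/\ 0 < q.2, subsquare x0 y0 s0 q.1.1 q.1.2 q.2 &
  m q.1.1 q.1.2 q.2 < `|I q.1.1 q.1.2 q.2| ].
pose next (q q' : R * R * R) := q'.2 = q.2 / 2 /\
  subsquare q.1.1 q.1.2 q.2 q'.1.1 q'.1.2 q'.2.
have step (q : {q | bad q}) : {q' : {q | bad q} | next (sval q) (sval q')}.
  apply: cid; case: q => -[[x y] s] [/= sp [xl xr yl yr] mI].
  have [h h0 sE] : exists2 h, 0 < h & s = h + h.
    by exists (s / 2); [rewrite divr_gt0|field].
  have half : (h + h) / 2 = h by field.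
  (* A quarter on which the inequality still fails. *)
  suff [x' [y' [hx hy mI']]] : exists x' y', [/\ (x' = x \/ x' = x + h),
      (y' = y \/ y' = y + h) & m x' y' h < `|I x' y' h|].
    have sub : subsquare x y s x' y' h.
      by rewrite sE; case: hx => hx; case: hy => hy; split; lra.
    have bq : bad (x', y', h).
      by case: sub => ? ? ? ?; split => //=; split; lra.
    by exists (exist _ _ bq); split => //=; rewrite sE half.
  apply: contrapT => H.
  have le x' y' : (x' = x \/ x' = x + h) -> (y' = y \/ y' = y + h) ->
      `|I x' y' h| <= m x' y' h.
    by move=> hx hy; rewrite leNgt; apply/negP => ?; apply: H; exists x', y'.
  have sub : subsquare x0 y0 s0 x y (h + h) by rewrite -sE.
  move: mI; rewrite sE ltNge => /negP; apply.
  apply: le_trans (msplit _ _ _ h0 sub); rewrite (Isplit _ _ _ h0 sub).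
  do 3 (apply: le_trans (ler_normD _ _) _; apply: lerD; last by apply: le; tauto).
  by apply: le; tauto.
have b0 : bad (x0, y0, s0) by split.
have [u [u0 unext]] := dependent_choice step (exist _ _ b0).
pose X n := (sval (u n)).1.1; pose Y n := (sval (u n)).1.2; pose S n := (sval (u n)).2.
have badn n : bad (X n, Y n, S n) by rewrite /X/Y/S -!surjective_pairing; exact: svalP.
have nextn n : next (X n, Y n, S n) (X n.+1, Y n.+1, S n.+1).
  by have := unext n; rewrite /X/Y/S -!surjective_pairing.
have S0 : S 0%N = s0 by rewrite /S u0.
have Spos n : 0 < S n by case: (badn n).
have SE n : S n = s0 / 2 ^+ n.
  elim: n => [|n IHn]; first by rewrite S0 expr0 divr1.
  by have [/= -> _] := nextn n; rewrite IHn exprSr invfM mulrA.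
have nest k n : subsquare (X n) (Y n) (S n) (X (n + k)%N) (Y (n + k)%N) (S (n + k)%N).
  elim: k => [|k [? ? ? ?]]; first by rewrite addn0; split.
  have [_ [/= ? ? ? ?]] := nextn (n + k)%N.
  by rewrite addnS; split; lra.
(* Every lower left corner is below every upper right corner, so the suprema
   of the corners are the coordinates of a point common to all the squares. *)
have cross n k : X n <= X k + S k /\ Y n <= Y k + S k.
  have Sn := Spos n; have Sk := Spos k.
  have [/subnK <-|/ltnW/subnK <-] := leqP n k.
    have [] := nest (k - n)%N n; rewrite addnC.
    have := Spos (k - n + n)%N; split; lra.
  have [] := nest (n - k)%N k; rewrite addnC.
  have := Spos (n - k + k)%N; split; lra.
have supP (Z : nat -> R) : (forall n k, Z n <= Z k + S k) ->
    forall k, Z k <= sup (range Z) <= Z k + S k.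
  move=> Zc k; apply/andP; split.
    apply: ub_le_sup; last by exists k.
    by exists (Z 0%N + S 0%N) => _ [n _ <-].
  by apply: ge_sup; [exists (Z k); exists k|move=> _ [n _ <-]].
have cP := supP X (fun n k => (cross n k).1).
have dP := supP Y (fun n k => (cross n k).2).
set c := sup (range X) in cP; set d := sup (range Y) in dP.
have inq n : in_square (X n) (Y n) (S n) c d.
  by have /andP[? ?] := cP n; have /andP[? ?] := dP n; split.
have X0 : X 0%N = x0 by rewrite /X u0.
have Y0 : Y 0%N = y0 by rewrite /Y u0.
have [|del del0 locP] := loc c d; first by have := inq 0%N; rewrite X0 Y0 S0.
have [n Sn] : exists n, S n < del.
  have half1 : `|2^-1 : R| < 1 by rewrite ger0_norm ?invr_ge0// invf_lt1// ltr1n.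
  have /cvgrPdist_lt /(_ (del / s0)) := cvg_expr half1.
  rewrite divr_gt0// => /(_ isT) [N _ /(_ N (leqnn N))] /=.
  rewrite sub0r normrN ger0_norm ?exprn_ge0 ?invr_ge0// => lt.
  by exists N; rewrite SE -exprVn mulrC -ltr_pdivlMr.
have [_ /= sub] := badn n.
by rewrite ltNge (locP _ _ _ (Spos n) Sn sub (inq n)).
Qed.

End FourSection.

(** * Goursat's lemma for closed forms on a square *)

Section Goursat.
Context {R : realType}.
Implicit Types (x y s : R) (p q : R -> R -> R).

(** Counterclockwise line integral of [p dx + q dy] along the boundary of the
    square of side [s] whose lower left corner is [(x, y)]. *)
Definition circulation p q x y s : R :=
  seg_int (p ^~ y) x (x + s) + seg_int (q (x + s)) y (y + s)
  - seg_int (p ^~ (y + s)) x (x + s) - seg_int (q x) y (y + s).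

Definition lines_continuous p q x0 y0 s0 : Prop :=
  (forall y, y0 <= y <= y0 + s0 -> {within `[x0, x0 + s0], continuous (p ^~ y)}) /\
  (forall x, x0 <= x <= x0 + s0 -> {within `[y0, y0 + s0], continuous (q x)}).

Lemma lines_continuous_sub p q x0 y0 s0 x y s :
  0 < s -> subsquare x0 y0 s0 x y s ->
  lines_continuous p q x0 y0 s0 -> lines_continuous p q x y s.
Proof.
move=> sp [? ? ? ?] [hp hq]; split=> t /andP[? ?].
  apply: (@continuous_subspaceW _ _ _ `[x0, x0 + s0]%classic); last by apply: hp; lra.
  by move=> u /=; rewrite !in_itv/= => /andP[? ?]; lra.
apply: (@continuous_subspaceW _ _ _ `[y0, y0 + s0]%classic); last by apply: hq; lra.
by move=> u /=; rewrite !in_itv/= => /andP[? ?]; lra.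
Qed.

Lemma circulation_split p q x y s : 0 < s -> lines_continuous p q x y (s + s) ->
  circulation p q x y (s + s) = circulation p q x y s + circulation p q (x + s) y s
    + circulation p q x (y + s) s + circulation p q (x + s) (y + s) s.
Proof.
move=> sp [hp hq]; rewrite /circulation.
have hx y' : y <= y' <= y + (s + s) -> seg_int (p ^~ y') x (x + (s + s)) =
    seg_int (p ^~ y') x (x + s) + seg_int (p ^~ y') (x + s) (x + s + s).
  by move=> /hp hy; rewrite -addrA; apply: seg_int_split => //; lra.
have hy x' : x <= x' <= x + (s + s) -> seg_int (q x') y (y + (s + s)) =
    seg_int (q x') y (y + s) + seg_int (q x') (y + s) (y + s + s).
  by move=> /hq h; rewrite -addrA; apply: seg_int_split => //; lra.
by rewrite !hx ?hy ?addrA; lra.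
Qed.

(** The affine model of the form is closed because its two cross coefficients are
    the same [b]: its circulation vanishes, and only the errors on the four sides
    remain. *)
Lemma circulation_near_closed p q x y s c d (p0 q0 a b a' e : R) : 0 < s ->
  lines_continuous p q x y s ->
  (forall u v, in_square x y s u v ->
    `|p u v - (p0 + a * (u - c) + b * (v - d))| <= e /\
    `|q u v - (q0 + b * (u - c) + a' * (v - d))| <= e) ->
  `|circulation p q x y s| <= 4 * e * s.
Proof.
move=> sp [hp hq] H.
have P v : y <= v <= y + s -> `|seg_int (p ^~ v) x (x + s) -
    ((p0 - a * c + b * (v - d)) * s + a * ((x + s) ^+ 2 - x ^+ 2) / 2)| <= e * s.
  move=> hv; have {2 4}-> : s = x + s - x by ring.
  apply: seg_int_near_affine; [lra|exact: hp|move=> t /andP[? ?]].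
  have [|+ _] := H t v; first by split; lra.
  by congr (`|_ - _| <= _); ring.
have Q u : x <= u <= x + s -> `|seg_int (q u) y (y + s) -
    ((q0 - a' * d + b * (u - c)) * s + a' * ((y + s) ^+ 2 - y ^+ 2) / 2)| <= e * s.
  move=> hu; have {2 4}-> : s = y + s - y by ring.
  apply: seg_int_near_affine; [lra|exact: hq|move=> t /andP[? ?]].
  have [|_ +] := H u t; first by split; lra.
  by congr (`|_ - _| <= _); ring.
have hx : x <= x <= x + s by lra.
have hxs : x <= x + s <= x + s by lra.
have hy : y <= y <= y + s by lra.
have hys : y <= y + s <= y + s by lra.
rewrite /circulation.
move: (P _ hy) (P _ hys) (Q _ hx) (Q _ hxs).
rewrite !ler_norml => /andP[? ?] /andP[? ?] /andP[? ?] /andP[? ?].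
by apply/andP; split; lra.
Qed.

(** The signed square root. Its increments define a measure on the line for which
    an interval of length [s] containing 0 weighs at least [sqrt s]. *)
Definition root_gauge (t : R) : R := Num.sqrt t - Num.sqrt (- t).

Lemma le_root_gauge t u : t <= u -> root_gauge t <= root_gauge u.
Proof.
by move=> tu; rewrite /root_gauge lerB// ler_wsqrtr// lerN2.
Qed.

Lemma root_gauge_increment t u : t <= 0 -> 0 <= u ->
  Num.sqrt (u - t) <= root_gauge u - root_gauge t.
Proof.
move=> t0 u0; rewrite /root_gauge (ler0_sqrtr t0) (@ler0_sqrtr _ (- u)) ?oppr_le0//.
rewrite subr0 sub0r opprK.
have -> : Num.sqrt u + Num.sqrt (- t) = Num.sqrt ((Num.sqrt u + Num.sqrt (- t)) ^+ 2).
  by rewrite sqrtr_sqr ger0_norm ?addr_ge0 ?sqrtr_ge0.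
apply: ler_wsqrtr; rewrite sqrrD !sqr_sqrtr ?oppr_ge0//.
by rewrite -addrA lerD2l lerDr mulrn_wge0// mulr_ge0 ?sqrtr_ge0.
Qed.

(** A product of two such measures centred at [e]: it is additive under
    quartering, yet a square of side [s] containing [e] weighs at least [s], not
    merely [s ^ 2]. *)
Definition point_gauge (e : R * R) x y s : R :=
  (root_gauge (x + s - e.1) - root_gauge (x - e.1)) *
  (root_gauge (y + s - e.2) - root_gauge (y - e.2)).

Lemma point_gauge_ge0 e x y s : 0 < s -> 0 <= point_gauge e x y s.
Proof.
by move=> sp; apply: mulr_ge0; rewrite subr_ge0; apply: le_root_gauge; lra.
Qed.

Lemma point_gauge_ge_side e x y s : 0 < s -> in_square x y s e.1 e.2 ->
  s <= point_gauge e x y s.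
Proof.
move=> sp [? ? ? ?]; rewrite -[leLHS](sqr_sqrtr (ltW sp)) expr2 /point_gauge.
apply: ler_pM; rewrite ?sqrtr_ge0//.
  by have := @root_gauge_increment (x - e.1) (x + s - e.1);
    rewrite (_ : x + s - e.1 - (x - e.1) = s); [apply; lra|ring].
by have := @root_gauge_increment (y - e.2) (y + s - e.2);
  rewrite (_ : y + s - e.2 - (y - e.2) = s); [apply; lra|ring].
Qed.

Lemma point_gauge_split e x y s : point_gauge e x y (s + s) =
  point_gauge e x y s + point_gauge e (x + s) y s
  + point_gauge e x (y + s) s + point_gauge e (x + s) (y + s) s.
Proof. by rewrite /point_gauge !addrA; ring. Qed.

(** Near a point where the form is differentiable and closed the circulation is
    [o(s ^ 2)]; near an exceptional point of [E] continuity only gives [o(s)],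
    which the gauge of that point still dominates. Bisection with the measure
    area + gauges bounds the circulation by an arbitrarily small multiple of it. *)
Theorem goursat_square p q (E : seq (R * R)) x0 y0 s0 : 0 < s0 ->
  lines_continuous p q x0 y0 s0 ->
  (forall c d, in_square x0 y0 s0 c d ->
    (exists a b a' : R, forall e : R, 0 < e -> exists2 del : R, 0 < del &
       forall u v, in_square x0 y0 s0 u v -> `|u - c| < del -> `|v - d| < del ->
       `|p u v - (p c d + a * (u - c) + b * (v - d))| <= e * (`|u - c| + `|v - d|) /\
       `|q u v - (q c d + b * (u - c) + a' * (v - d))| <= e * (`|u - c| + `|v - d|))
    \/ ((c, d) \in E /\ forall e : R, 0 < e -> exists2 del : R, 0 < del &
       forall u v, in_square x0 y0 s0 u v -> `|u - c| < del -> `|v - d| < del ->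
       `|p u v - p c d| <= e /\ `|q u v - q c d| <= e)) ->
  circulation p q x0 y0 s0 = 0.
Proof.
move=> s00 lc loc.
pose m x y s := s ^+ 2 + \sum_(e <- E) point_gauge e x y s.
have close x y s c d u v del : s < del -> in_square x y s c d ->
    in_square x y s u v -> [/\ `|u - c| < del, `|v - d| < del,
      `|u - c| <= s & `|v - d| <= s].
  by move=> ? [? ? ? ?] [? ? ? ?]; rewrite !ltr_norml !ler_norml; split; lra.
have insub x y s u v : subsquare x0 y0 s0 x y s -> in_square x y s u v ->
    in_square x0 y0 s0 u v.
  by move=> [? ? ? ?] [? ? ? ?]; split; lra.
have bound e : 0 < e -> `|circulation p q x0 y0 s0| <= e * m x0 y0 s0.
  move=> ep; apply: (@square_bisection _ (circulation p q) (fun x y s => e * m x y s)) => //.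
  - move=> x y s sp sub; apply: circulation_split => //.
    by apply: lines_continuous_sub lc => //; rewrite addr_gt0.
  - move=> x y s sp _; rewrite -!mulrDr ler_wpM2l ?(ltW ep)// /m.
    rewrite (eq_bigr _ (fun e' _ => point_gauge_split e' x y s)).
    by rewrite !big_split /=; lra.
  - move=> c d /loc [[a [b [a' H]]]|[cdE H]].
    + have [|del del0 {}H] := H (e / 8); first by rewrite divr_gt0.
      exists del => // x y s sp sdel sub cd.
      apply: (@le_trans _ _ (4 * (e / 8 * (s + s)) * s)).
        apply: (@circulation_near_closed _ _ _ _ _ c d (p c d) (q c d) a b a') => //.
          exact: lines_continuous_sub lc.
        move=> u v uv; have [ud vd us vs] := close _ _ _ _ _ _ _ _ sdel cd uv.
        have [hp hq] := H u v (insub _ _ _ _ _ sub uv) ud vd.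
        have le : e / 8 * (`|u - c| + `|v - d|) <= e / 8 * (s + s).
          by rewrite ler_wpM2l ?lerD// divr_ge0// ltW.
        by split; [apply: le_trans hp le|apply: le_trans hq le].
      rewrite /m [leRHS]mulrDr [leLHS](_ : _ = e * s ^+ 2); last by field.
      rewrite lerDl mulr_ge0 ?(ltW ep)// sumr_ge0// => e' _; exact: point_gauge_ge0.
    + have [|del del0 {}H] := H (e / 4); first by rewrite divr_gt0.
      exists del => // x y s sp sdel sub cd.
      apply: (@le_trans _ _ (4 * (e / 4) * s)).
        apply: (@circulation_near_closed _ _ _ _ _ c d (p c d) (q c d) 0 0 0) => //.
          exact: lines_continuous_sub lc.
        move=> u v uv; have [ud vd us vs] := close _ _ _ _ _ _ _ _ sdel cd uv.
        by have := H u v (insub _ _ _ _ _ sub uv) ud vd; rewrite !mul0r !addr0.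
      have -> : 4 * (e / 4) * s = e * s by field.
      rewrite ler_wpM2l ?(ltW ep)// /m (big_rem _ cdE) /= addrCA.
      apply: ler_wpDr; last exact: (point_gauge_ge_side (e := (c, d))).
      by rewrite addr_ge0 ?sqr_ge0// sumr_ge0// => e' _; exact: point_gauge_ge0.
have mp : 0 < m x0 y0 s0.
  rewrite /m ltr_pwDl ?exprn_gt0// sumr_ge0// => e' _; exact: point_gauge_ge0.
apply/eqP; rewrite -normr_le0; apply/ler_addgt0Pr => e ep; rewrite add0r.
by have := bound (e / m x0 y0 s0) (divr_gt0 ep mp); rewrite divfK// gt_eqF.
Qed.

End Goursat.

(** * Complex differentiability and division by zeros *)

Section ComplexNeighbourhoods.
Context {R : realType}.
Implicit Types (z w a : R[i]) (f q : R[i] -> R[i]).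

Lemma norm_le_ReIm z : `|z| <= (`|complex.Re z| + `|complex.Im z|)%:C.
Proof.
rewrite normc_def lecR -[leRHS]ger0_norm ?addr_ge0// -sqrtr_sqr.
apply: ler_wsqrtr; rewrite sqrrD !real_normK ?num_real//.
by rewrite -addrA lerD2l lerDr mulrn_wge0// mulr_ge0.
Qed.

Lemma Re_le_norm z (r : R) : `|z| <= r%:C -> `|complex.Re z| <= r.
Proof.
rewrite normc_def lecR; apply: le_trans; rewrite -sqrtr_sqr.
by apply: ler_wsqrtr; rewrite lerDl sqr_ge0.
Qed.

Lemma Im_le_norm z (r : R) : `|z| <= r%:C -> `|complex.Im z| <= r.
Proof.
rewrite normc_def lecR; apply: le_trans; rewrite -sqrtr_sqr.
by apply: ler_wsqrtr; rewrite lerDr sqr_ge0.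
Qed.

Lemma gt0_complexE (e : R[i]) : 0 < e -> exists2 r : R, 0 < r & e = r%:C.
Proof.
case: e => [r s]; rewrite ltcE /= => /andP[/eqP s0 r0].
by exists r; rewrite // s0.
Qed.

(** The topology of [R[i]] comes from a norm with values in [R[i]] itself; boxes turn
    it into statements about real numbers. *)
Lemma nbhs_boxP z (U : set R[i]) : nbhs z U <->
  exists2 d : R, 0 < d & forall w, `|complex.Re w - complex.Re z| < d ->
    `|complex.Im w - complex.Im z| < d -> U w.
Proof.
split.
  move=> /nbhs_ballP[_ /= /gt0_complexE[r r0 ->] zU].
  exists (r / 2); first by rewrite divr_gt0.
  move=> w re im; apply: zU; rewrite -ball_normE /=.
  rewrite distrC; apply: le_lt_trans (norm_le_ReIm _) _.
  by rewrite ltcR !raddfB /= (splitr r) ltrD.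
move=> [d d0 H]; apply/nbhs_ballP; exists ((d / 2)%:C).
  by rewrite /= ltcR divr_gt0.
move=> w; rewrite -ball_normE /= distrC => /ltW wz.
have [re im] := (Re_le_norm wz, Im_le_norm wz).
rewrite !raddfB /= in re im.
have d2 : d / 2 < d by lra.
by apply: H; apply: le_lt_trans d2.
Qed.

Lemma continuous_boxP f z : {for z, continuous f} ->
  forall e : R, 0 < e -> exists2 d : R, 0 < d &
    forall w, `|complex.Re w - complex.Re z| < d -> `|complex.Im w - complex.Im z| < d ->
      `|f w - f z| <= e%:C.
Proof.
move=> cf e e0; apply: (iffLR (nbhs_boxP z (fun w => `|f w - f z| <= e%:C))).
have e0' : (0 : R[i]) < e%:C by rewrite ltcR.
move/cvgrPdist_le: cf => /(_ _ e0').
by apply: filterS => w; rewrite distrC.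
Qed.

Lemma for_continuousD f q z : {for z, continuous f} -> {for z, continuous q} ->
  {for z, continuous (fun w => f w + q w)}.
Proof. move=> cf cq; exact: (@cvgD _ _ _ (nbhs z) _ f q _ _ cf cq). Qed.

Lemma for_continuousB f q z : {for z, continuous f} -> {for z, continuous q} ->
  {for z, continuous (fun w => f w - q w)}.
Proof. move=> cf cq; exact: (@cvgB _ _ _ (nbhs z) _ f q _ _ cf cq). Qed.

Lemma for_continuousM f q z : {for z, continuous f} -> {for z, continuous q} ->
  {for z, continuous (fun w => f w * q w)}.
Proof. move=> cf cq; exact: (@cvgM _ _ (nbhs z) _ f q _ _ cf cq). Qed.

Lemma for_continuousV f z : f z != 0 -> {for z, continuous f} -> {for z, continuous (fun w => (f w)^-1)}.
Proof. move=> fz cf; exact: (@cvgV _ _ (nbhs z) _ f _ fz cf). Qed.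

Lemma for_continuous_cst c z : {for z, continuous (fun=> c : R[i])}.
Proof. exact: (@cst_continuous _ _ c z). Qed.

Lemma for_continuous_id z : {for z, continuous (fun w => w)}.
Proof. exact: cvg_id. Qed.

Lemma for_continuous_shift a z : {for z, continuous (fun w => w - a)}.
Proof. exact: for_continuousB (@for_continuous_id z) (@for_continuous_cst a z). Qed.

Lemma for_continuous_near f q z : (\forall w \near z, f w = q w) ->
  {for z, continuous q} -> {for z, continuous f}.
Proof.
move=> fq; rewrite /continuous_at /prop_for (nbhs_singleton fq).
apply: cvg_trans; apply: (@near_eq_cvg _ _ (nbhs z) _ q f).
by apply: filterS fq => w /= ->.
Qed.

(** Caratheodory's form of differentiability at [z]: it makes products and
    quotients purely algebraic. *)
Definition cdiff f z := exists q, {for z, continuous q} /\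
  \forall w \near z, f w = f z + (w - z) * q w.

Lemma cdiff_continuous f z : cdiff f z -> {for z, continuous f}.
Proof.
move=> [q [cq fE]]; apply: (for_continuous_near fE).
exact: for_continuousD (@for_continuous_cst (f z) z)
  (for_continuousM (@for_continuous_shift z z) cq).
Qed.

Lemma derivable_cdiff f z : derivable f z 1 -> cdiff f z.
Proof.
move=> /cvg_ex[l lim].
pose q w := if w == z then l else (f w - f z) / (w - z).
exists q; split; last first.
  apply: (@filterE _ (nbhs z)) => w; rewrite /q; have [->|wz] := eqVneq w z.
    by rewrite subrr mul0r addr0.
  by rewrite mulrC divfK ?subr_eq0// addrC subrK.
rewrite /continuous_at /prop_for /q eqxx.
apply/(@cvgrPdist_le _ _ _ (nbhs z)) => e e0.
move/cvgrPdist_le: lim => /(_ _ e0).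
rewrite /dnbhs/= near_withinE => lim0.
have := @for_continuous_shift z z.
rewrite /continuous_at /prop_for subrr => shift0.
apply: (@filterS _ (nbhs z) _ _ _ _ (shift0 _ lim0)) => w /=.
have [->|wz] := eqVneq w z; first by move=> _; rewrite [X in `|X|]subrr normr0 ltW.
by rewrite subr_eq0 wz => /(_ isT); rewrite /GRing.scale/= mulr1 subrK mulrC.
Qed.

Lemma cdiff_near f g z : (\forall w \near z, f w = g w) -> cdiff g z -> cdiff f z.
Proof.
move=> fg [q [cq gE]]; exists q; split => //.
have fgz : f z = g z by exact: nbhs_singleton fg.
by near=> w; rewrite fgz; rewrite (near fg)//; near: w.
Unshelve. all: by end_near. Qed.

Lemma near_neq z a : z != a -> \forall w \near z, w != a.
Proof.
move=> za; have : nbhs z (~` [set a]).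
  apply: open_nbhs_nbhs; split; last exact/eqP.
  apply: closed_openC; apply: accessible_closed_set1.
  by apply: hausdorff_accessible; exact: norm_hausdorff.
by apply: filterS => w /eqP.
Qed.

Lemma cdiff_shift f c z : cdiff f z -> cdiff (fun w => f w - c) z.
Proof.
move=> [q [cq fE]]; exists q; split => //.
by apply: filterS fE => w ->; rewrite addrAC.
Qed.

Lemma cdiff_scale f z c : cdiff f z -> cdiff (fun w => f w * c) z.
Proof.
move=> [q [cq fE]]; exists (fun w => q w * c); split.
  exact: for_continuousM cq (@for_continuous_cst c z).
by apply: filterS fE => w ->; ring.
Qed.

Lemma cdiff_divide f z a : z != a -> cdiff f z -> cdiff (fun w => f w / (w - a)) z.
Proof.
move=> za [q [cq fE]].
have za0 : z - a != 0 by rewrite subr_eq0.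
exists (fun w => (q w * (z - a) - f z) / ((w - a) * (z - a))); split.
  apply: (@for_continuousM (fun w => q w * (z - a) - f z)).
    apply: (for_continuousB _ (@for_continuous_cst (f z) z)).
    exact: for_continuousM cq (@for_continuous_cst (z - a) z).
  apply: (@for_continuousV (fun w => (w - a) * (z - a))); first by rewrite mulf_neq0.
  exact: for_continuousM (@for_continuous_shift a z) (@for_continuous_cst (z - a) z).
near=> w.
have wa0 : w - a != 0 by rewrite subr_eq0; near: w; exact: near_neq.
rewrite (near fE w)//; field.
by rewrite wa0 za0.
Unshelve. all: by end_near. Qed.

(** The quotient is [f w / (w - a)] off [a] and Caratheodory's slope at [a]. It stays
    continuous at [a], but its differentiability there is not claimed: that would
    already be the removable singularity theorem. *)
Lemma factor_zero f a : cdiff f a -> f a = 0 -> exists h,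
  [/\ (forall w, f w = (w - a) * h w), {for a, continuous h},
      (forall z, {for z, continuous f} -> {for z, continuous h}) &
      (forall z, z != a -> cdiff f z -> cdiff h z)].
Proof.
move=> [q [cq fE]] fa.
pose h w := if w == a then q a else f w / (w - a).
have ch : {for a, continuous h}.
  apply: for_continuous_near cq.
  apply: filterS fE => w; rewrite fa add0r /h; have [->//|wa] := eqVneq w a.
  by move=> ->; rewrite mulrC mulKf ?subr_eq0.
have hE z : z != a -> \forall w \near z, h w = f w / (w - a).
  by move=> /near_neq; apply: filterS => w /negbTE wa; rewrite /h wa.
exists h; split; [|exact: ch| |].
- move=> w; rewrite /h; have [->|wa] := eqVneq w a; first by rewrite subrr mul0r.
  by rewrite mulrC divfK ?subr_eq0.
- move=> z cf; have [->|za] := eqVneq z a; first exact: ch.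
  apply: (@for_continuous_near h (fun w => f w / (w - a)) z (hE _ za)).
  apply: (@for_continuousM f (fun w => (w - a)^-1) z cf).
  apply: (@for_continuousV (fun w => w - a) z); last exact: for_continuous_shift.
  by rewrite subr_eq0.
- by move=> z za df; apply: cdiff_near (hE _ za) (cdiff_divide za df).
Qed.

(** Iterating the division costs differentiability only at the divided zeros. *)
Lemma factor_zeros f (U : set R[i]) (zs : seq R[i]) :
  uniq zs -> (forall z, U z -> cdiff f z) ->
  (forall z, z \in zs -> U z /\ f z = 0) ->
  exists h, [/\ (forall w, f w = (\prod_(a <- zs) (w - a)) * h w),
    (forall z, U z -> {for z, continuous h}) &
    (forall z, U z -> z \notin zs -> cdiff h z)].
Proof.
move=> + df; elim: zs => [|a zs IH] /=.
  move=> _ _; exists f; split => [w|z /df/cdiff_continuous//|z /df//].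
  by rewrite big_nil mul1r.
move=> /andP[azs uzs] H.
have [z zzs|g [gE cg dg]] := IH uzs; first by apply: H; rewrite inE zzs orbT.
have [Ua fa] := H a (mem_head _ _).
have ga : g a = 0.
  have /eqP := gE a; rewrite fa eq_sym mulf_eq0 => /orP[|/eqP//].
  rewrite prodf_seq_eq0 => /hasP[b bzs /=]; rewrite subr_eq0 => /eqP ab.
  by rewrite ab bzs in azs.
have [h [hE ha ch dh]] := factor_zero (dg _ Ua azs) ga.
exists h; split.
- by move=> w; rewrite big_cons gE hE; ring.
- by move=> z Uz; exact: ch (cg _ Uz).
- by move=> z Uz; rewrite inE negb_or => /andP[za zzs]; apply: dh (dg _ Uz zzs).
Qed.

End ComplexNeighbourhoods.

(** * Goursat's lemma for complex functions, and a weak maximum principle *)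

Section IsolatedZeros.
Context {R : realType}.
Implicit Types (z w a : R[i]) (f g k : R[i] -> R[i]).

Lemma line_continuous k (line : R -> R[i]) (part : R[i] -> R) t :
  (forall u v, `|complex.Re (line u) - complex.Re (line v)| <= `|u - v|) ->
  (forall u v, `|complex.Im (line u) - complex.Im (line v)| <= `|u - v|) ->
  (forall z w r, `|z - w| <= r%:C -> `|part z - part w| <= r) ->
  {for line t, continuous k} -> {for t, continuous (part \o k \o line)}.
Proof.
move=> hre him hpart ck; apply/(@cvgrPdist_le _ _ _ (nbhs t)) => e e0.
have [d d0 H] := continuous_boxP ck e0.
apply/nbhs_ballP; exists d => //= u; rewrite -ball_normE /= => tu.
rewrite distrC; apply: hpart; apply: H; rewrite distrC.
  by apply: le_lt_trans (hre _ _) tu.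
by apply: le_lt_trans (him _ _) tu.
Qed.

Lemma Re_part_le z w (r : R) : `|z - w| <= r%:C -> `|complex.Re z - complex.Re w| <= r.
Proof. by move=> /Re_le_norm; rewrite raddfB. Qed.

Lemma Im_part_le z w (r : R) : `|z - w| <= r%:C -> `|complex.Im z - complex.Im w| <= r.
Proof. by move=> /Im_le_norm; rewrite raddfB. Qed.

Lemma lines_continuous_complex k x0 y0 s0 :
  (forall x y, in_square x0 y0 s0 x y -> {for x +i* y, continuous k}) ->
  lines_continuous (fun x y => complex.Im (k (x +i* y)))
    (fun x y => complex.Re (k (x +i* y))) x0 y0 s0.
Proof.
move=> ck; split.
  move=> y /andP[? ?]; apply: continuous_in_subspaceT => x /set_mem /=.
  rewrite in_itv /= => /andP[? ?].
  apply: (@line_continuous k (fun x => x +i* y) (@complex.Im R)).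
  - by move=> u v /=.
  - by move=> u v /=; rewrite subrr normr0.
  - exact: Im_part_le.
  - exact: ck.
move=> x /andP[? ?]; apply: continuous_in_subspaceT => y /set_mem /=.
rewrite in_itv /= => /andP[? ?].
apply: (@line_continuous k (fun y => x +i* y) (@complex.Re R)).
- by move=> u v /=; rewrite subrr normr0.
- by move=> u v /=.
- exact: Re_part_le.
- exact: ck.
Qed.

(** The imaginary part of [k dz] is the form [Im k dx + Re k dy]; complex
    differentiability is exactly closedness of its linear part. *)
Theorem goursat_complex k (zs : seq R[i]) x0 y0 s0 : 0 < s0 ->
  (forall x y, in_square x0 y0 s0 x y -> {for x +i* y, continuous k}) ->
  (forall x y, in_square x0 y0 s0 x y -> x +i* y \notin zs -> cdiff k (x +i* y)) ->
  circulation (fun x y => complex.Im (k (x +i* y))) (fun x y => complex.Re (k (x +i* y)))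
    x0 y0 s0 = 0.
Proof.
move=> s00 ck dk.
apply: (@goursat_square _ _ _ [seq (complex.Re z, complex.Im z) | z <- zs]) => //.
  exact: lines_continuous_complex.
move=> c d cd; have [cdE|/(dk _ _ cd)] := boolP (c +i* d \in zs).
  right; split; first by apply/mapP; exists (c +i* d).
  move=> e e0; have [del del0 H] := continuous_boxP (ck _ _ cd) e0.
  exists del => // u v _ uc vd; have kk := H (u +i* v) uc vd.
  by split; [exact: Im_part_le|exact: Re_part_le].
move=> [q [cq /nbhs_boxP[d1 d10 kE]]]; left.
case qcd : (q (c +i* d)) => [al be]; exists be, al, (- be) => e e0.
have [d2 d20 H] := continuous_boxP cq e0.
exists (Num.min d1 d2); first by rewrite lt_min d10.
move=> u v _; rewrite !lt_min => /andP[uc1 uc2] /andP[vd1 vd2].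
have /= kuv := kE (u +i* v) uc1 vd1.
have quv := H (u +i* v) uc2 vd2.
pose rest := (u +i* v - c +i* d) * (q (u +i* v) - q (c +i* d)).
have kuvE : k (u +i* v) = k (c +i* d) +
    (u +i* v - c +i* d) * q (c +i* d) + rest.
  by rewrite kuv /rest; ring.
have restle : `|rest| <= (e * (`|u - c| + `|v - d|))%:C.
  rewrite normrM mulrC rmorphM /= ler_pM// ?normr_ge0//.
  by apply: le_trans (norm_le_ReIm _) _; rewrite /= lexx.
rewrite qcd in kuvE.
split.
  have := Im_le_norm restle; congr (`|_| <= _); rewrite kuvE.
  by case: (rest) (k (c +i* d)) => ? ? [? ?] /=; ring.
have := Re_le_norm restle; congr (`|_| <= _); rewrite kuvE.
by case: (rest) (k (c +i* d)) => ? ? [? ?] /=; ring.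
Qed.

(** The sign of one side of the boundary integral of [(g - 1) / (z - a)], with the
    side moved by a rotation to a position where [1 / (z - a)] is
    [(t + i r) / (r ^ 2 + t ^ 2)]. As [g] is small, [g - 1] is close to [-1]. *)
Lemma side_sign (r t gr gi kr ki : R) : 0 < r -> `|t| <= r ->
  `|gr| <= 1 / 4 -> `|gi| <= 1 / 4 ->
  gr - 1 = t * kr + r * ki -> gi = t * ki - r * kr -> ki <= - (4 * r)^-1.
Proof.
move=> r0 tr hgr hgi e1 e2.
have kE : (r ^+ 2 + t ^+ 2) * ki = r * (gr - 1) + t * gi by rewrite e1 e2; ring.
have t2 : t ^+ 2 <= r ^+ 2 by rewrite -(real_normK (num_real t)) lerXn2r ?nnegrE// ltW.
have tgi : t * gi <= r * (1 / 4).
  by apply: le_trans (ler_norm _) _; rewrite normrM ler_pM.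
have gr4 : gr <= 1 / 4 by apply: le_trans (ler_norm _) hgr.
have neg : (r ^+ 2 + t ^+ 2) * ki <= - (r / 2) by rewrite kE; nra.
rewrite -(ler_pM2l (_ : 0 < 4 * r)) ?mulr_gt0// mulrN mulfV ?mulf_neq0 ?gt_eqF//.
have kile0 : ki <= 0.
  rewrite leNgt; apply/negP => ki0.
  have : 0 <= (r ^+ 2 + t ^+ 2) * ki by rewrite mulr_ge0 ?addr_ge0 ?sqr_ge0 ?ltW.
  by move/le_trans => /(_ _ neg); rewrite oppr_ge0 leNgt divr_gt0.
rewrite -(ler_pM2l r0).
have : (r ^+ 2 + r ^+ 2) * ki <= (r ^+ 2 + t ^+ 2) * ki.
  by rewrite ler_wnM2r// lerD2l.
lra.
Qed.

(** A weak form of the maximum principle, for functions that may fail to be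
    differentiable at finitely many points. Otherwise Goursat's lemma applies to
    [k = (g - 1) / (z - a)], where [a] is the centre; but on the boundary [g - 1] is
    close to [-1], so that each of the four sides contributes negatively to the
    integral of [Im (k dz)], which then cannot vanish. *)
Lemma no_small_boundary g (zs : seq R[i]) (b c r : R) : 0 < r ->
  (forall x y, in_square (b - r) (c - r) (r + r) x y -> {for x +i* y, continuous g}) ->
  (forall x y, in_square (b - r) (c - r) (r + r) x y -> x +i* y \notin zs ->
    cdiff g (x +i* y)) ->
  b +i* c \notin zs -> g (b +i* c) = 1 ->
  (forall x y, in_square (b - r) (c - r) (r + r) x y ->
    r = `|x - b| \/ r = `|y - c| -> `|g (x +i* y)| <= (1 / 4)%:C) -> False.
Proof.
move=> r0 cg dg azs ga small.
have sq_bc : in_square (b - r) (c - r) (r + r) b c by split; lra.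
have ga1 : g (b +i* c) - 1 = 0 by rewrite ga subrr.
have [k [kE ck cck dk]] := factor_zero (cdiff_shift 1 (dg _ _ sq_bc azs)) ga1.
have ckQ x y : in_square (b - r) (c - r) (r + r) x y -> {for x +i* y, continuous k}.
  by move=> /cg cxy; apply: cck; exact: for_continuousB cxy (@for_continuous_cst _ 1 _).
have r20 : 0 < r + r by rewrite addr_gt0.
have circ0 : circulation (fun x y => complex.Im (k (x +i* y)))
    (fun x y => complex.Re (k (x +i* y))) (b - r) (c - r) (r + r) = 0.
  apply: (@goursat_complex k ((b +i* c) :: zs)) => // x y xy.
  rewrite inE negb_or => /andP[xa xzs]; apply: dk => //.
  by apply: cdiff_shift; exact: dg.
have [lp lq] := lines_continuous_complex ckQ.
have parts x y : in_square (b - r) (c - r) (r + r) x y ->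
    r = `|x - b| \/ r = `|y - c| ->
    [/\ `|complex.Re (g (x +i* y))| <= 1 / 4, `|complex.Im (g (x +i* y))| <= 1 / 4,
    complex.Re (g (x +i* y)) - 1 = (x - b) * complex.Re (k (x +i* y))
      - (y - c) * complex.Im (k (x +i* y)) &
    complex.Im (g (x +i* y)) = (x - b) * complex.Im (k (x +i* y))
      + (y - c) * complex.Re (k (x +i* y))].
  move=> xy bd; have gs := small _ _ xy bd; split.
  - exact: Re_le_norm.
  - exact: Im_le_norm.
  - have := congr1 (@complex.Re R) (kE (x +i* y)).
    by case: (g _) (k _) => ? ? [? ?] /= ->.
  - have := congr1 (@complex.Im R) (kE (x +i* y)).
    by case: (g _) (k _) => ? ? [? ?] /=; rewrite subr0 => ->.
have m0 : 0 < (4 * r)^-1 by rewrite invr_gt0 mulr_gt0.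
set m := (4 * r)^-1 in m0.
have bE : b - r + (r + r) = b + r by ring.
have cE : c - r + (r + r) = c + r by ring.
rewrite /circulation bE cE in circ0 lp lq.
have inq (x y : R) : b - r <= x <= b + r -> c - r <= y <= c + r ->
    in_square (b - r) (c - r) (r + r) x y.
  by move=> /andP[? ?] /andP[? ?]; split; lra.
have hb : b - r <= b + r by lra.
have hc : c - r <= c + r by lra.
have nr (u v : R) : u = v + r \/ u = v - r -> r = `|u - v|.
  move=> [->|->]; first by rewrite addrC addKr gtr0_norm.
  by rewrite addrC addKr normrN gtr0_norm.
have cen (u v : R) : v - r <= u <= v + r -> `|u - v| <= r.
  by move=> /andP[? ?]; rewrite ler_norml; apply/andP; split; lra.
have hxb : b - r <= b - r <= b + r by lra.
have hxt : b - r <= b + r <= b + r by lra.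
have hyb : c - r <= c - r <= c + r by lra.
have hyt : c - r <= c + r <= c + r by lra.
have tN (t : R) : `|t| <= r -> `|- t| <= r by rewrite normrN.
have bottom : seg_int (fun x => complex.Im (k (x +i* (c - r)))) (b - r) (b + r) <=
    - m * (b + r - (b - r)).
  apply: seg_int_le => //; first exact: lp.
  move=> x hx; have [||h1 h2 e1 e2] := parts x (c - r).
  - exact: inq.
  - by right; apply: nr; right.
  apply: (side_sign r0 (cen _ _ hx) h1 h2 (kr := complex.Re (k (x +i* (c - r))))).
    by rewrite e1; ring.
  by rewrite e2; ring.
have right : seg_int (fun y => complex.Re (k ((b + r) +i* y))) (c - r) (c + r) <=
    - m * (c + r - (c - r)).
  apply: seg_int_le => //; first exact: lq.
  move=> y hy; have [||h1 h2 e1 e2] := parts (b + r) y.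
  - exact: inq.
  - by left; apply: nr; left.
  apply: (side_sign r0 (cen _ _ hy) h1 h2 (kr := - complex.Im (k ((b + r) +i* y)))).
    by rewrite e1; ring.
  by rewrite e2; ring.
have top : m * (b + r - (b - r)) <=
    seg_int (fun x => complex.Im (k (x +i* (c + r)))) (b - r) (b + r).
  apply: seg_int_ge => //; first exact: lp.
  move=> x hx; have [||h1 h2 e1 e2] := parts x (c + r).
  - exact: inq.
  - by right; apply: nr; left.
  rewrite -lerN2.
  apply: (side_sign r0 (tN _ (cen _ _ hx)) h1 h2
    (kr := - complex.Re (k (x +i* (c + r))))).
    by rewrite e1; ring.
  by rewrite e2; ring.
have left : m * (c + r - (c - r)) <=
    seg_int (fun y => complex.Re (k ((b - r) +i* y))) (c - r) (c + r).
  apply: seg_int_ge => //; first exact: lq.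
  move=> y hy; have [||h1 h2 e1 e2] := parts (b - r) y.
  - exact: inq.
  - by left; apply: nr; right.
  rewrite -lerN2.
  apply: (side_sign r0 (tN _ (cen _ _ hy)) h1 h2
    (kr := complex.Im (k ((b - r) +i* y)))).
    by rewrite e1; ring.
  by rewrite e2; ring.
have mr : 0 < m * r by rewrite mulr_gt0.
lra.
Qed.

Lemma distinct_zeros f z0 n (U : set R[i]) : nbhs z0 U ->
  (forall V, nbhs z0 V -> exists z, [/\ z != z0, f z = 0 & V z]) ->
  exists zs : seq R[i], [/\ uniq zs, size zs = n &
    forall z, z \in zs -> [/\ z != z0, U z & f z = 0]].
Proof.
move=> z0U acc; elim: n => [|n [zs [uzs szs H]]]; first by exists [::].
have V : nbhs z0 [set z | U z /\ z \notin zs].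
  elim: zs {uzs szs} H => [|z zs IH] H.
    by apply: filterS z0U.
  have [|+ _ _] := H z; first by rewrite mem_head.
  rewrite eq_sym => /near_neq z0z.
  have {}IH : nbhs z0 [set w | U w /\ w \notin zs].
    by apply: IH => w wzs; apply: H; rewrite inE wzs orbT.
  apply: filterS2 IH z0z => w [Uw wzs] wz.
  by split; rewrite // inE negb_or wz.
have [z [zz0 fz [Uz zzs]]] := acc _ V.
exists (z :: zs); split => /=; rewrite ?zzs ?szs//.
by move=> w; rewrite inE => /predU1P[->|/H].
Qed.

End IsolatedZeros.

(** * Accumulation of zeros *)

Section AccumulatingZeros.
Context {R : realType}.
Implicit Types (z w a : R[i]) (f : R[i] -> R[i]).

Let dist_lt_trans (u v w b c d : R) :
  `|u - w| <= b -> `|w - v| < c -> b + c <= d -> `|u - v| < d.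
Proof.
move=> uw wv; apply: lt_le_trans.
by apply: le_lt_trans (ler_distD w _ _) _; rewrite ler_ltD.
Qed.

Let dist_common (u v c d : R) : `|u - c| < d -> `|v - c| < d -> `|u - v| <= 2 * d.
Proof.
move=> uc vc; apply: le_trans (ler_distD c _ _) _.
by rewrite mulr_natl mulr2n (distrC c) lerD// ltW.
Qed.

Let dist_far (x u v d e : R) : `|u - v| <= d -> e + d <= `|x - u| -> e <= `|x - v|.
Proof.
move=> uv h; rewrite -(lerD2r d); apply: le_trans h _.
by apply: le_trans (ler_distD v _ _) _; rewrite lerD2l distrC.
Qed.

Lemma real_modulus z : exists2 m : R, 0 <= m & `|z| = m%:C.
Proof.
exists (Num.sqrt (complex.Re z ^+ 2 + complex.Im z ^+ 2)); first exact: sqrtr_ge0.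
by rewrite normc_def.
Qed.

Lemma prod_dist_ge (zs : seq R[i]) a w :
  (forall z, z \in zs -> `|a - z| *+ 2 <= `|w - z|) ->
  2 ^+ size zs * \prod_(z <- zs) `|a - z| <= \prod_(z <- zs) `|w - z|.
Proof.
elim: zs => [|z l IH] far; first by rewrite !big_nil expr0 mulr1.
rewrite !big_cons /= exprS mulrACA.
rewrite ler_pM ?mulr_ge0 ?normr_ge0 ?exprn_ge0 ?prodr_ge0//.
  by rewrite mulr_natl; apply: far; rewrite mem_head.
by apply: IH => z' z'l; apply: far; rewrite inE z'l orbT.
Qed.

(** Suppose [f a] is nonzero at a point [a] near [z0]. Dividing [f] by [n] factors
    [w - z_j], for distinct zeros [z_j] close to [z0], yields [h], and on the
    boundary of a square around [a] the ratio [h w / h a] is at most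
    [|f w| / |f a|] times [2 ^ (- n)], because [|a - z_j| <= |w - z_j| / 2]. For
    large [n] this contradicts the weak maximum principle. Neither power series
    nor the removable singularity theorem is involved. *)
Theorem accumulating_zeros f z0 : (\forall z \near z0, cdiff f z) ->
  (forall V, nbhs z0 V -> exists z, [/\ z != z0, f z = 0 & V z]) ->
  \forall z \near z0, f z = 0.
Proof.
move=> /nbhs_boxP[d1 d10 df] acc.
have z0diff : cdiff f z0 by apply: df; rewrite subrr normr0.
have [d2 d20 fb] := continuous_boxP (cdiff_continuous z0diff) ltr01.
pose rho := Num.min d1 d2.
have rho0 : 0 < rho by rewrite lt_min d10.
have [M M0 ME] := real_modulus (f z0).
have fM w : `|complex.Re w - complex.Re z0| < rho ->
    `|complex.Im w - complex.Im z0| < rho -> `|f w| <= (M + 1)%:C.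
  rewrite !lt_min => /andP[_ h1] /andP[_ h2].
  rewrite -(subrK (f z0) (f w)) rmorphD/= -ME addrC.
  by apply: le_trans (ler_normD _ _) _; rewrite lerD2l fb.
have fd w : `|complex.Re w - complex.Re z0| < rho ->
    `|complex.Im w - complex.Im z0| < rho -> cdiff f w.
  by rewrite !lt_min => /andP[h1 _] /andP[h2 _]; exact: df.
(* Half the side of the square is [16 del]; the centre and the zeros lie within
   [del] of [z0], in each coordinate. *)
have [del del0 rhoE] : exists2 del : R, 0 < del & rho = 32 * del.
  by exists (rho / 32); [rewrite divr_gt0|field].
have [del_rho r_del_rho far_del] :
    [/\ del <= rho, 16 * del + del <= rho & 14 * del + 2 * del <= 16 * del].
  by clear -del0 rhoE; split; lra.
pose r := 16 * del; have r0 : 0 < r by rewrite mulr_gt0.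
apply/nbhs_boxP; exists del => // a ha1 ha2.
apply: contrapT => /eqP fa0.
have fa_gt0 : 0 < `|f a| by rewrite normr_gt0.
have [ma ma0 maE] := gt0_complexE fa_gt0.
(* Enough zeros to beat the ratio of [M + 1] to [|f a|] by a factor 4. *)
pose n := Num.bound (4 * (M + 1) / ma).
have nM : 4 * (M + 1) <= 2 ^+ n * ma.
  rewrite -ler_pdivrMr//; apply: ltW; exact: upper_nthrootP.
pose U := [set w : R[i] | `|complex.Re w - complex.Re z0| < del /\
  `|complex.Im w - complex.Im z0| < del].
have z0U : nbhs z0 U by apply/nbhs_boxP; exists del => // w ? ?; split.
have [zs [uzs szs zsP]] := distinct_zeros n z0U acc.
pose box : set R[i] := [set w | `|complex.Re w - complex.Re z0| < rho /\
    `|complex.Im w - complex.Im z0| < rho].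
have [||h [hE ch dh]] := @factor_zeros _ f box zs uzs.
- by move=> z [? ?]; exact: fd.
- move=> z /zsP[_ [hz1 hz2] fz]; split; last exact: fz.
  by split; [exact: lt_le_trans hz1 del_rho|exact: lt_le_trans hz2 del_rho].
have azs : a \notin zs.
  by apply/negP => /zsP[_ _ /eqP]; rewrite (negbTE fa0).
have ha0 : h a != 0.
  by apply: contra_neq fa0 => ha0; rewrite hE ha0 mulr0.
have inbox x y : in_square (complex.Re a - r) (complex.Im a - r) (r + r) x y ->
    box (x +i* y).
  move=> xy; have [xr yr] : `|x - complex.Re a| <= r /\ `|y - complex.Im a| <= r.
    by clear -xy; case: xy => *; rewrite !ler_norml; split; apply/andP; split; lra.
  split; first exact: dist_lt_trans xr ha1 r_del_rho.
  exact: dist_lt_trans yr ha2 r_del_rho.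
have aE : complex.Re a +i* complex.Im a = a by case: (a).
apply: (@no_small_boundary _ (fun w => h w / h a) zs (complex.Re a) (complex.Im a) r).
- exact: r0.
- move=> x y /inbox bxy.
  exact: for_continuousM (ch _ bxy) (@for_continuous_cst _ (h a)^-1 _).
- by move=> x y /inbox bxy /(dh _ bxy); exact: cdiff_scale.
- by rewrite aE.
- by rewrite aE mulfV.
move=> x y xy bd; set w := x +i* y.
have [bw1 bw2] := inbox _ _ xy.
have fw := fM _ bw1 bw2.
have far z : z \in zs -> `|a - z| *+ 2 <= `|w - z|.
  move=> /zsP[_ [hz1 hz2] _].
  have re := dist_common ha1 hz1; have im := dist_common ha2 hz2.
  have [m m0 mE] := real_modulus (w - z).
  have wzle : `|w - z| <= m%:C by rewrite mE.
  have wz : 14 * del <= m.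
    case: bd => rE.
      by apply: le_trans (Re_part_le wzle); apply: dist_far re _; rewrite -rE.
    by apply: le_trans (Im_part_le wzle); apply: dist_far im _; rewrite -rE.
  rewrite mE; apply: le_trans (_ : (2 * del + 2 * del)%:C *+ 2 <= _).
    rewrite lerMn2r; apply: le_trans (norm_le_ReIm _) _.
    by rewrite lecR !raddfB /= lerD.
  by rewrite -rmorphMn /= lecR; apply: le_trans wz; clear -del0; lra.
have prodle := prod_dist_ge far; rewrite szs in prodle.
have PA0 : 0 < \prod_(z <- zs) `|a - z|.
  rewrite big_seq; apply: prodr_gt0 => z zzs; rewrite normr_gt0 subr_eq0.
  by apply: contraNneq azs => ->.
have PW0 : 0 < \prod_(z <- zs) `|w - z|.
  by apply: lt_le_trans prodle; rewrite mulr_gt0// exprn_gt0.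
have K0 : 0 < `|h a| by rewrite normr_gt0.
rewrite hE normrM normr_prod in fw.
rewrite hE normrM normr_prod in maE.
rewrite normrM normfV ler_pdivrMr// rmorphM fmorphV /= mul1r rmorph_nat mulrC.
rewrite ler_pdivlMr// -(ler_pM2l PW0).
apply: le_trans (_ : (M + 1)%:C * 4 <= _); first by rewrite mulrA ler_pM2r.
apply: le_trans (_ : 2 ^+ n * ma%:C <= _).
  rewrite mulrC -(rmorph_nat (real_complex R)) -(rmorph_nat (real_complex R) 2).
  by rewrite -rmorphM -rmorphXn -rmorphM /= lecR.
by rewrite -maE mulrA ler_pM2r.
Qed.

End AccumulatingZeros.

(** * Alternative rings and the complexification *)

Section Alternative.
Variables (V : zmodType) (mul : V -> V -> V).
Local Notation "x * y" := (mul x y) : ring_scope.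
Hypothesis mulDl : forall x y z, (x + y) * z = x * z + y * z.
Hypothesis mulDr : forall x y z, x * (y + z) = x * y + x * z.
Hypothesis altl : forall x y, x * (x * y) = x * x * y.
Hypothesis altr : forall x y, x * (y * y) = x * y * y.

Lemma alternative_linl x y a : x * (y * a) + y * (x * a) = x * y * a + y * x * a.
Proof.
have := altl (x + y) a; rewrite !mulDl !mulDr !mulDl !altl.
by rewrite -!addrA => /addrI; rewrite !addrA => /addIr.
Qed.

Lemma alternative_linr x y z : x * y * z + x * z * y = x * (y * z) + x * (z * y).
Proof.
have := esym (altr x (z + y)); rewrite !(mulDr, mulDl) -!altr.
by rewrite -!addrA => /addrI; rewrite !addrA => /addIr.
Qed.

Lemma alternative_flexible a y : a * (y * a) = a * y * a.
Proof. by have := alternative_linr a y a; rewrite altl => /addIr. Qed.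

(** Three instances of the linearized alternative laws: both sides differ by
    [x (y a^2) + y (x a^2) - (x (y a) + y (x a)) a], which vanishes. *)
Lemma right_moufang x a y : x * a * y * a = x * (a * y * a).
Proof.
have e1 := alternative_linl (x * a) y a.
have e2 := alternative_linr x a (y * a).
have e3 : x * (y * a) * a + y * (x * a) * a = x * (y * (a * a)) + y * (x * (a * a)).
  by rewrite -mulDl alternative_linl mulDl -!altr alternative_linl.
apply: (addIr (y * (x * a) * a)); rewrite -e1.
apply: (addIr (x * (y * a) * a)); rewrite addrAC e2 -!addrA.
congr (_ + _); last by rewrite [RHS]addrC e3 !altr.
by rewrite alternative_flexible.
Qed.

(** Associativity fails, so [(x a) b] cannot simply be reassociated. But
    [a b^2 a = 1] by the right alternative law, and the Moufang identity turns this into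
    [((x a) b^2) a = x]. *)
Lemma right_mul_injective e a b : (forall x, x * e = x) -> (forall x, e * x = x) ->
  a * b = e -> b * a = e -> forall x, x * a = 0 -> x = 0.
Proof.
move=> mulr1 mul1r ab ba x xa.
have mul0 y : 0 * y = 0 by apply: (addrI (0 * y)); rewrite -mulDl !addr0.
by rewrite -(mulr1 x) -ba -[b]mul1r -ab -altr -right_moufang xa !mul0.
Qed.

End Alternative.

Section Complexification.
Context {R : realType} {A : altStarAlgType R}.
Implicit Types (x y u v w : A) (a b c : A * A).

Lemma altmulDr u v w : u ** (v + w) = u ** v + u ** w.
Proof. by have := alt_mul_linearr u 1 v w; rewrite !scale1r. Qed.

Lemma altmulDl u v w : (u + v) ** w = u ** w + v ** w.
Proof. by have := alt_mul_linearl w 1 u v; rewrite !scale1r. Qed.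

Lemma altmul0r u : u ** 0 = 0.
Proof. by apply: (addrI (u ** 0)); rewrite -altmulDr !addr0. Qed.

Lemma altmul0l u : 0 ** u = 0.
Proof. by apply: (addrI (0 ** u)); rewrite -altmulDl !addr0. Qed.

Lemma altmulZr r u v : u ** (r *: v) = r *: (u ** v).
Proof. by have := alt_mul_linearr u r v 0; rewrite altmul0r !addr0. Qed.

Lemma altmulZl r u v : (r *: u) ** v = r *: (u ** v).
Proof. by have := alt_mul_linearl v r u 0; rewrite altmul0l !addr0. Qed.

Lemma altmulNr u v : u ** (- v) = - (u ** v).
Proof. by rewrite -scaleN1r altmulZr scaleN1r. Qed.

Lemma altmulNl u v : (- u) ** v = - (u ** v).
Proof. by rewrite -scaleN1r altmulZl scaleN1r. Qed.

Lemma cplx_mulDl a b c : cplx_mul (a + b) c = cplx_mul a c + cplx_mul b c.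
Proof.
rewrite /cplx_mul /= !altmulDl.
by congr pair => /=; rewrite ?opprD addrACA.
Qed.

Lemma cplx_mulDr a b c : cplx_mul a (b + c) = cplx_mul a b + cplx_mul a c.
Proof.
rewrite /cplx_mul /= !altmulDr.
by congr pair => /=; rewrite ?opprD addrACA.
Qed.

Lemma cplx_mul1r a : cplx_mul a cplx_one = a.
Proof.
by case: a => a b; rewrite /cplx_mul /= !alt_mul1r !altmul0r subr0 add0r.
Qed.

Lemma cplx_mul1l a : cplx_mul cplx_one a = a.
Proof.
by case: a => a b; rewrite /cplx_mul /= !alt_mul1l !altmul0l subr0 addr0.
Qed.

Let linl x y u : x ** (y ** u) + y ** (x ** u) = x ** y ** u + y ** x ** u.
Proof.
by apply: alternative_linl => *; rewrite ?altmulDl ?altmulDr ?alt_mul_altl.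
Qed.

Let linr x y u : x ** y ** u + x ** u ** y = x ** (y ** u) + x ** (u ** y).
Proof.
by apply: alternative_linr => *; rewrite ?altmulDl ?altmulDr ?alt_mul_altr.
Qed.

Let regroupB (V : zmodType) (p q r s t : V) : q + r = t -> p - q - (r + s) = p - s - t.
Proof. by move=> <-; rewrite !opprD (AC (2*2) ((1*4)*(2*3))). Qed.

Let regroupD (V : zmodType) (p q r s t : V) : q + r = t -> p + q + (r - s) = p - s + t.
Proof. by move=> <-; rewrite (AC (2*2) ((1*4)*(2*3))). Qed.

Lemma cplx_altl a b : cplx_mul a (cplx_mul a b) = cplx_mul (cplx_mul a a) b.
Proof.
case: a b => [x y] [u v]; rewrite /cplx_mul /=.
rewrite !(altmulDr, altmulDl, altmulNr, altmulNl, alt_mul_altl).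
by congr pair; [apply: regroupB|apply: regroupD]; exact: linl.
Qed.

Lemma cplx_altr a b : cplx_mul a (cplx_mul b b) = cplx_mul (cplx_mul a b) b.
Proof.
case: a b => [x y] [u v]; rewrite /cplx_mul /=.
rewrite !(altmulDr, altmulDl, altmulNr, altmulNl, alt_mul_altr).
by congr pair; rewrite -linr; [exact: regroupB|exact: regroupD].
Qed.

Lemma cplx_invertible_mul_injective a : cplx_invertible a ->
  forall c, cplx_mul c a = 0 -> c = 0.
Proof.
move=> [b [ab ba]].
exact: (right_mul_injective cplx_mulDl cplx_mulDr cplx_altl cplx_altr
  cplx_mul1r cplx_mul1l ab ba).
Qed.

Lemma pseudosphere_sqr (I : A) : pseudosphere I -> I ** I = - alt_one.
Proof.
move=> [+ IIc]; rewrite addrC => /eqP; rewrite addr_eq0 => /eqP cI.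
by rewrite -IIc cI altmulNr opprK.
Qed.

(** A zero on the sphere of [z] reads [F' + I F'' = 0], that is,
    [F(z) = (i - I) F''], and [(I + i) (i - I) = - 1 - I^2 = 0]; left alternativity suffices
    to reassociate here. *)
Lemma slice_zero_left_annihilator (I : A) a : pseudosphere I ->
  a.1 + I ** a.2 = 0 -> cplx_mul (I, alt_one) a = 0.
Proof.
move=> SI /eqP; rewrite addr_eq0 => /eqP aE.
rewrite /cplx_mul /= aE !alt_mul1l subrr altmulNr alt_mul_altl pseudosphere_sqr//.
by rewrite altmulNl opprK alt_mul1l subrr.
Qed.

End Complexification.

(** * The determinant of right multiplication *)

Section RightMultiplicationMatrix.
Context {R : realType} {A : altStarAlgType R}.
Implicit Types (a b c : A * A) (t : R[i]).

Local Notation n := (\dim {:A}).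
Local Notation basis := (vbasis {:A}).

(** The complex scalar multiplication of the complexification, which carries only
    its real vector space structure as a product type. *)
Definition cplx_scale t a : A * A :=
  (complex.Re t *: a.1 - complex.Im t *: a.2, complex.Re t *: a.2 + complex.Im t *: a.1).

Definition real_basis (i : 'I_n) : A * A := (basis`_i, 0).

Definition cplx_uncoord (v : 'rV[R[i]]_n) : A * A :=
  \sum_i cplx_scale (v 0 i) (real_basis i).

(** The matrix, acting on row vectors, of right multiplication by [b]. *)
Definition rmul_mx b : 'M[R[i]]_n := \matrix_i cplx_coord (cplx_mul (real_basis i) b).

Lemma cplx_coordD : {morph @cplx_coord R A : a b / a + b}.
Proof.
by move=> a b; apply/rowP => i; rewrite !mxE; apply/eqP; rewrite eq_complex /= !linearD !eqxx.
Qed.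

Lemma cplx_coord0 : cplx_coord (0 : A * A) = 0.
Proof. by apply: (addrI (cplx_coord 0)); rewrite -cplx_coordD !addr0. Qed.

Lemma cplx_coordZ t a : cplx_coord (cplx_scale t a) = t *: cplx_coord a.
Proof.
apply/rowP => i; rewrite !mxE; case: t => s u; apply/eqP.
by rewrite eq_complex /= linearB linearD /= !linearZ /= !eqxx.
Qed.

Lemma cplx_mul_scalel t a b : cplx_mul (cplx_scale t a) b = cplx_scale t (cplx_mul a b).
Proof.
rewrite /cplx_mul /cplx_scale /= !altmulDl !altmulNl !altmulZl !scalerDr !scalerN.
by congr pair; rewrite ?opprD (AC (2*2) ((1*3)*(4*2))).
Qed.

Lemma cplx_uncoordK : cancel cplx_uncoord (@cplx_coord R A).
Proof.
move=> v; rewrite /cplx_uncoord (big_morph _ cplx_coordD cplx_coord0).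
rewrite [RHS]row_sum_delta; apply: eq_bigr => i _; rewrite cplx_coordZ; congr (_ *: _).
apply/rowP => j; rewrite !mxE /= linear0 coord_free ?(basis_free (vbasisP _))//.
by rewrite eq_sym; case: (_ == _).
Qed.

Lemma cplx_coordK : cancel (@cplx_coord R A) cplx_uncoord.
Proof.
move=> a; rewrite /cplx_uncoord.
rewrite [LHS]surjective_pairing (big_morph fst (fun _ _ => erefl) erefl).
rewrite (big_morph snd (fun _ _ => erefl) erefl) [RHS]surjective_pairing; congr pair.
  rewrite [RHS](coord_vbasis (memvf a.1)); apply: eq_bigr => i _.
  by rewrite mxE /= scaler0 subr0.
rewrite [RHS](coord_vbasis (memvf a.2)); apply: eq_bigr => i _.
by rewrite mxE /= scaler0 add0r.
Qed.

Lemma mul_rmul_mx (v : 'rV[R[i]]_n) b :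
  v *m rmul_mx b = cplx_coord (cplx_mul (cplx_uncoord v) b).
Proof.
have mul0 : cplx_mul 0 b = 0.
  by apply: (addrI (cplx_mul 0 b)); rewrite -cplx_mulDl !addr0.
rewrite /cplx_uncoord (big_morph (cplx_mul^~ b) (fun x y => cplx_mulDl x y b) mul0).
rewrite (big_morph _ cplx_coordD cplx_coord0) mulmx_sum_row.
by apply: eq_bigr => i _; rewrite rowK cplx_mul_scalel cplx_coordZ.
Qed.

Lemma det_rmul_mx_eq0 b :
  \det (rmul_mx b) = 0 <-> exists a, a != 0 /\ cplx_mul a b = 0.
Proof.
split.
  move/eqP/det0P => [v v0 vb]; exists (cplx_uncoord v); split.
    by apply: contraNneq v0 => v0; rewrite -(cplx_uncoordK v) v0 cplx_coord0.
  by rewrite -[LHS]cplx_coordK -mul_rmul_mx vb -cplx_coord0 cplx_coordK.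
move=> [a [a0 ab]]; apply/eqP/det0P; exists (cplx_coord a).
  by apply: contraNneq a0 => ca; rewrite -(cplx_coordK a) ca -cplx_coord0 cplx_coordK.
by rewrite mul_rmul_mx cplx_coordK ab cplx_coord0.
Qed.

Lemma det_rmul_mx_bar b : \det (rmul_mx (cplx_bar b)) = (\det (rmul_mx b))^*%C.
Proof.
rewrite -det_map_mx; congr (\det _); apply/matrixP => i j; rewrite !mxE /=.
by rewrite !altmul0l !subr0 !addr0 altmulNr linearN.
Qed.

(** Entries depend linearly on the coordinates of [b], with the structure constants
    of [A] as coefficients; hence they are holomorphic whenever [b] is. *)
Lemma rmul_mxE b i j : rmul_mx b i j =
  \sum_k cplx_coord b 0 k * (coord basis j (basis`_i ** basis`_k))%:C.
Proof.
rewrite !mxE /= !altmul0l subr0 addr0.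
have mulE u : coord basis j (basis`_i ** u) =
    \sum_k coord basis k u * coord basis j (basis`_i ** basis`_k).
  rewrite {1}(coord_vbasis (memvf u)).
  rewrite (big_morph _ (altmulDr basis`_i) (altmul0r _)) linear_sum.
  by apply: eq_bigr => k _; rewrite altmulZr linearZ.
rewrite !mulE; apply/eqP; rewrite eq_complex !raddf_sum /=.
by apply/andP; split; apply/eqP/eq_bigr => k _; rewrite mxE /= ?mulr0 ?subr0 ?add0r.
Qed.

End RightMultiplicationMatrix.

Section HolomorphicDeterminant.
Context {R : realType}.
Implicit Types (f g : R[i] -> R[i]) (z : R[i]).

Lemma cdiff_cst (c : R[i]) z : cdiff (fun=> c) z.
Proof.
exists (fun=> 0); split; first exact: for_continuous_cst.
by apply: (@filterE _ (nbhs z)) => w; rewrite mulr0 addr0.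
Qed.

Lemma cdiffD f g z : cdiff f z -> cdiff g z -> cdiff (fun w => f w + g w) z.
Proof.
move=> [q [cq fE]] [p [cp gE]]; exists (fun w => q w + p w); split.
  exact: for_continuousD.
by apply: filterS2 fE gE => w -> ->; ring.
Qed.

Lemma cdiffM f g z : cdiff f z -> cdiff g z -> cdiff (fun w => f w * g w) z.
Proof.
move=> df dg; have cf := cdiff_continuous df.
case: df dg => [q [cq fE]] [p [cp gE]].
exists (fun w => q w * g z + f w * p w); split.
  exact: for_continuousD (for_continuousM cq (@for_continuous_cst _ (g z) z))
    (for_continuousM cf cp).
by apply: filterS2 fE gE => w -> ->; ring.
Qed.

Lemma cdiff_sum (I : Type) (r : seq I) (P : pred I) (F : I -> R[i] -> R[i]) z :
  (forall i, P i -> cdiff (F i) z) -> cdiff (fun w => \sum_(i <- r | P i) F i w) z.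
Proof.
move=> dF; elim: r => [|i r IH].
  rewrite (_ : (fun _ => _) = fun=> 0); first exact: cdiff_cst.
  by apply/funext => w; rewrite big_nil.
rewrite (_ : (fun _ => _) = fun w => if P i then F i w + \sum_(j <- r | P j) F j w
  else \sum_(j <- r | P j) F j w); last by apply/funext => w; rewrite big_cons.
case Pi: (P i) => //.
exact: cdiffD (dF _ Pi) IH.
Qed.

Lemma cdiff_prod (I : Type) (r : seq I) (P : pred I) (F : I -> R[i] -> R[i]) z :
  (forall i, P i -> cdiff (F i) z) -> cdiff (fun w => \prod_(i <- r | P i) F i w) z.
Proof.
move=> dF; elim: r => [|i r IH].
  rewrite (_ : (fun _ => _) = fun=> 1); first exact: cdiff_cst.
  by apply/funext => w; rewrite big_nil.
rewrite (_ : (fun _ => _) = fun w => if P i then F i w * \prod_(j <- r | P j) F j w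
  else \prod_(j <- r | P j) F j w); last by apply/funext => w; rewrite big_cons.
case Pi: (P i) => //.
exact: cdiffM (dF _ Pi) IH.
Qed.

Lemma cdiff_det n (M : R[i] -> 'M[R[i]]_n) z :
  (forall i j, cdiff (fun w => M w i j) z) -> cdiff (fun w => \det (M w)) z.
Proof.
move=> dM; apply: cdiff_sum => s _; apply: cdiffM; first exact: cdiff_cst.
by apply: cdiff_prod => i _; exact: dM.
Qed.

Lemma derivable_entry n (M : R[i] -> 'rV[R[i]]_n) z j :
  derivable M z 1 -> derivable (fun w => M w 0 j) z 1.
Proof.
move=> /cvg_ex[l lim]; apply/cvg_ex; exists (l 0 j).
rewrite (_ : (fun h : R[i] => _) = (fun N : 'rV[R[i]]_n => N 0 j) \o
  (fun h : R[i] => h^-1 *: ((M \o shift z) (h *: 1) - M z))).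
  exact: (@cvg_comp _ _ _ _ (fun N : 'rV[R[i]]_n => N 0 j) _ _ _ lim
    (@coord_continuous _ _ _ 0 j l)).
by apply/funext => h /=; rewrite !mxE.
Qed.

Lemma cdiff_det_rmul_mx (A : altStarAlgType R) (F : R[i] -> A * A) z :
  derivable (cplx_coord \o F : R[i] -> 'rV[R[i]]__) z 1 ->
  cdiff (fun w => \det (rmul_mx (F w))) z.
Proof.
move=> dF; apply: cdiff_det => i j;
rewrite (_ : (fun _ => _) = fun w => \sum_k cplx_coord (F w) 0 k *
  (coord (vbasis {:A}) j ((vbasis {:A})`_i ** (vbasis {:A})`_k))%:C); last first.
  by apply/funext => w; rewrite rmul_mxE.
apply: cdiff_sum => k _; apply: cdiff_scale; apply: derivable_cdiff.
exact: derivable_entry dF.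
Qed.

End HolomorphicDeterminant.

(** * The identity theorem on a symmetric domain *)

Section IdentityTheorem.
Context {R : realType}.
Implicit Types (z w : R[i]) (G W : set R[i]).
Local Open Scope quotient_scope.

Lemma nbhs_conj z (U : set R[i]) : nbhs z U -> nbhs z^*%C [set w | U w^*%C].
Proof.
move=> /nbhs_boxP[d d0 H]; apply/nbhs_boxP; exists d => // w re im.
apply: H; first by case: w z re im => [? ?] [? ?] /=.
by case: w z re im => [? ?] [? ?] /= _; rewrite -opprD normrN opprK.
Qed.

(** Only the quotient of [G] by conjugation is connected ([G] itself may consist of
    two conjugate components), so the clopen set must be conjugation invariant to
    descend to it. *)
Lemma symmetric_domain_clopen G W : symmetric_domain G -> W `<=` G ->
  (forall z, W z -> W z^*%C) -> open W ->
  (forall z, G z -> ~ W z -> \forall w \near z, ~ W w) ->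
  W !=set0 -> G `<=` W.
Proof.
move=> [oG symG conn] WG Wconj Wopen Wclosed [z1 Wz1].
pose Q := conj_quotient G.
pose B : set Q := [set q | W (val (repr q))].
have piW (z : set_type G) : B (\pi_Q z) <-> W (val z).
  have /eqquotP := reprK (\pi_Q z : Q).
  rewrite /B /= => /orP[/eqP->//|/eqP->]; split => [/Wconj|/Wconj//].
  by rewrite conjcK.
have relopen (N : set R[i]) (P : set (set_type G)) : open N ->
    (forall x : set_type G, P x <-> N (val x)) -> open P.
  move=> oN PN; rewrite (_ : P = (fun z : set_type G => val z) @^-1` N).
    by apply: open_comp oN => z _; exact: initial_continuous.
  by apply/seteqP; split => z /PN.
have Bopen : open B.
  exact: (relopen W).
have Bclosed : closed B.
  rewrite -[B]setCK; apply: open_closedC.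
  apply: (relopen (interior (~` W))); first exact: open_interior.
  move=> z; split => [nBz|/interior_subset + /piW//].
  by apply: Wclosed; [exact: set_valP|move=> /piW].
have BT : B = setT.
  apply: conn.
  - exists (\pi_Q (SigSub (mem_set (WG _ Wz1)) : set_type G)).
    exact/piW.
  - by exists B => //; rewrite setTI.
  - by exists B => //; rewrite setTI.
move=> z Gz; have : B (\pi_Q (SigSub (mem_set Gz) : set_type G)) by rewrite BT.
by move/piW.
Qed.

(** The points near which [g] vanishes identically form such a set; if zeros
    accumulated in [G], it would contain [p]. *)
Theorem zeros_discrete G g : symmetric_domain G -> (forall z, G z -> cdiff g z) ->
  (forall z, G z -> g z = 0 -> g z^*%C = 0) -> (exists p, G p /\ g p <> 0) ->
  forall z, G z -> ~ limit_point [set w | g w = 0] z.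
Proof.
move=> symdom dg gconj [p [Gp gp0]]; have [oG symG _] := symdom.
have nearG z : G z -> \forall w \near z, G w by move=> Gz; apply: open_nbhs_nbhs; split.
pose W := [set z | G z /\ \forall w \near z, g w = 0].
have limW z : G z -> limit_point [set w | g w = 0] z -> W z.
  move=> Gz lim; split; first exact: Gz.
  apply: accumulating_zeros.
    by apply: filterS (nearG _ Gz); exact: dg.
  by move=> V /lim [w [wz gw Vw]]; exists w.
have openW : open W.
  rewrite openE => z [Gz gz]; rewrite /interior /=.
  by apply: filterS2 (nearG _ Gz) (nbhs_interior gz).
move=> z Gz /(limW _ Gz) Wz; apply: gp0.
suff /(_ p Gp) [_ gp] : G `<=` W by exact: nbhs_singleton gp.
apply: (symmetric_domain_clopen symdom).
- by move=> w [].
- move=> w [Gw gw].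
  have Gw' : G w^*%C := (symG w).1 Gw; split; first exact: Gw'.
  apply: filterS2 (nearG _ Gw') (nbhs_conj gw) => u Gu /= gu.
  by rewrite -[u]conjcK; exact: gconj ((symG u).1 Gu) gu.
- exact: openW.
- move=> w Gw nWw; apply: contrapT => H; apply: (nWw); apply: (limW _ Gw) => V Vw.
  apply: contrapT => nV; apply: H; apply: filterS Vw => u Vu [Gu gu].
  have [uw|uw] := eqVneq u w; first by apply: nWw; rewrite -uw; split.
  by apply: nV; exists u; split; [exact: uw|exact: (nbhs_singleton gu)|exact: Vu].
- by exists z.
Qed.

End IdentityTheorem.

(** * Zeros of slice regular functions *)

Section ZerosOfSliceFunctions.
Context {R : realType} {A : altStarAlgType R}.
Implicit Types (x y : R) (I w : A) (G : set R[i]) (F : R[i] -> A * A) (f : A -> A).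

Lemma pseudosphereN I : pseudosphere I -> pseudosphere (- I).
Proof.
move=> [h1 h2].
have conjN : alt_conj (- I) = - alt_conj I.
  have conj0 : alt_conj 0 = 0 :> A by have := @alt_conj_real _ A 0; rewrite scale0r.
  by have := @alt_conj_linear _ A (-1) I 0; rewrite !scaleN1r conj0 !addr0.
by split; rewrite conjN; [rewrite -opprD h1 oppr0|rewrite altmulNl altmulNr opprK].
Qed.

(** Saturating the zero set by spheres makes the second condition of adaptedness
    automatic. *)
Definition zero_spheres G f : set A := [set w | exists x y I J,
  [/\ G (x +i* y), pseudosphere I, pseudosphere J, f (slice_pt x y J) = 0
    & w = slice_pt x y I]].

Lemma slice_ptN x y I : slice_pt x (- y) (- I) = slice_pt x y I :> A.
Proof. by rewrite /slice_pt scaleNr scalerN opprK. Qed.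

Lemma zero_spheres_full G f x y :
  slice_sphere x y `<=` zero_spheres G f \/
  is_subset1 (slice_sphere x y `&` zero_spheres G f).
Proof.
have [[w [[I SI wE] [x' [y' [I' [J [Gxy SI' SJ fJ wE']]]]]]]|H] :=
  pselect (slice_sphere x y `&` zero_spheres G f !=set0); last first.
  by right => u v hu; case: H; exists u.
left=> _ [K SK <-].
have [xx yy] : x = x' /\ `|y| = `|y'|.
  suff [] : x +i* `|y| = x' +i* `|y'| by [].
  apply: (@slice_proj_fun _ _ w); first by exists x, y, I.
  by exists x', y', I'.
have [yE|yE] : y = y' \/ y = - y'.
  by move/eqP: yy; rewrite eqr_norm2 => /orP[/eqP|/eqP]; [left|right].
  by exists x', y', K, J; split => //; rewrite xx yE.
exists x', y', (- K), J; split => //; first exact: pseudosphereN.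
by rewrite xx yE -slice_ptN opprK.
Qed.

End ZerosOfSliceFunctions.

Theorem proposition16p3 (R : realType) (A : altStarAlgType R)
    (G : set (complex R)) (F : complex R -> A * A) (f : A -> A)
    (hG : symmetric_domain G)
    (hF : stem_function G F)
    (hf : slice_induced G F f)
    (hinv : exists p, G p /\ cplx_invertible (F p)) :
  exists D : set A, adapted G D /\ slice_zeros G f `<=` D.
Proof.
have [holF conjF] := hF; have [p [Gp Fp]] := hinv.
pose g z := \det (rmul_mx (F z)).
have gconj z : G z -> g z = 0 -> g z^*%C = 0.
  by move=> Gz; rewrite /g conjF// det_rmul_mx_bar => ->; rewrite conjc0.
have gp : g p <> 0.
  move=> /det_rmul_mx_eq0[a [/eqP a0 aF]]; apply: a0.
  exact: cplx_invertible_mul_injective Fp _ aF.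
have one0 (I : A) : (I, alt_one) != 0 :> A * A.
  by rewrite xpair_eqE negb_and alt_one_neq0 orbT.
exists (zero_spheres G f); split; first split.
- by move=> _ [x [y [I [J [Gxy SI _ _ ->]]]]]; exists x, y, I.
- move=> z [Gz _] lim.
  have dg w : G w -> cdiff g w by move=> Gw; apply: cdiff_det_rmul_mx; exact: holF.
  apply: (zeros_discrete hG dg gconj _ Gz); first by exists p.
  move=> U /lim [u [uz [w [x [y [I [J [Gxy SI SJ fJ wE]]]]] wu] Uu]].
  exists u; split => //=.
  have -> : u = x +i* `|y| by apply: (slice_proj_fun wu); exists x, y, I.
  have gxy : g (x +i* y) = 0.
    apply/det_rmul_mx_eq0; exists (J, alt_one); split => //.
    by apply: slice_zero_left_annihilator => //; rewrite -hf.
  case: (ler0P y) => _ //.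
  by have := gconj _ Gxy gxy.
- exact: zero_spheres_full.
- by move=> w [[x [y [I [Gxy SI wE]]]] fw]; exists x, y, I, I; split; rewrite // -wE.
Qed.
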